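(* Let $G$ be a Lie group with $G/G^\circ$ finite. Let $\Gamma$ be a finitely generated group and let $\phi:G\longrightarrow\Gamma$ be an abstract surjective homomorphism. Then $\Gamma$ is finite and $\phi$ is continuous and open, where $\Gamma$ carries the discrete topology.
   Context: $G^\circ$ denotes the identity component of $G$. Lie groups are real, finite-dimensional and Hausdorff. Every countable group (in particular every finitely generated group) is viewed as a discrete group. A homomorphism between topological groups is called abstract if no continuity assumption is made on it. *)

(* Defs.v *)
From HB Require Import structures.
From mathcomp Require Import all_boot all_order all_algebra.
From mathcomp Require Import all_classical all_reals all_analysis.
Import numFieldNormedType.Exports.

Set Implicit Arguments.
Unset Strict Implicit.
Unset Printing Implicit Defensive.

Local Open Scope classical_set_scope.
Local Open Scope ring_scope.

(* For finite-dimensional V and open U: continuity of the Frechet derivative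
   x |-> 'd f x is the same as continuity of x |-> 'd f x v for each v.  Only
   used with V = 'rV_n or V = 'rV_n * 'rV_n. *)
Fixpoint Ck_on (R : realType) (V W : normedModType R) (k : nat)
    (U : set V) (f : V -> W) : Prop :=
  if k is k'.+1 then
    (forall x, U x -> differentiable f x) /\
    (forall v : V, Ck_on k' U (fun x => 'd f x v))
  else forall x, U x -> {for x, continuous f}.

Definition smooth_on (R : realType) (V W : normedModType R)
    (U : set V) (f : V -> W) : Prop := forall k, Ck_on k U f.

(* The maps are total functions; their values outside of chart_dom and
   chart_img are irrelevant. *)
Record chart (R : realType) (V : normedModType R) (M : topologicalType) :=
  Chart {
    chart_dom : set M;
    chart_img : set V;
    chart_fun : M -> V;
    chart_inv : V -> M;
    chart_dom_open : open chart_dom;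
    chart_img_open : open chart_img;
    chart_fun_img : forall x, chart_dom x -> chart_img (chart_fun x);
    chart_inv_dom : forall u, chart_img u -> chart_dom (chart_inv u);
    chart_funK : forall x, chart_dom x -> chart_inv (chart_fun x) = x;
    chart_invK : forall u, chart_img u -> chart_fun (chart_inv u) = u;
    chart_fun_continuous :
      forall x, chart_dom x -> {for x, continuous chart_fun};
    chart_inv_continuous :
      forall u, chart_img u -> {for u, continuous chart_inv} }.

Definition smooth_atlas (R : realType) (V : normedModType R)
    (M : topologicalType) (A : set (chart V M)) : Prop :=
  (forall x, exists2 c, A c & chart_dom c x) /\
  (forall c d, A c -> A d ->
    smooth_on (chart_img c `&` chart_inv c @^-1` chart_dom d)
              (chart_fun d \o chart_inv c)).

Definition smooth_map (R : realType) (V W : normedModType R)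
    (M N : topologicalType) (A : set (chart V M)) (B : set (chart W N))
    (f : M -> N) : Prop :=
  continuous f /\
  (forall c d, A c -> B d ->
    smooth_on (chart_img c `&` (f \o chart_inv c) @^-1` chart_dom d)
              (chart_fun d \o f \o chart_inv c)).

Section ProductChart.
Context (R : realType) (V W : normedModType R) (M N : topologicalType).
Variables (c : chart V M) (d : chart W N).

Let dom : set (M * N) := chart_dom c `*` chart_dom d.
Let img : set (V * W) := chart_img c `*` chart_img d.
Let fwd (x : M * N) : V * W := (chart_fun c x.1, chart_fun d x.2).
Let bwd (u : V * W) : M * N := (chart_inv c u.1, chart_inv d u.2).

Let openX (S T : topologicalType) (A : set S) (B : set T) :
  open A -> open B -> open (A `*` B).
Proof.
rewrite !openE => oA oB [x y] [/= Ax By]; rewrite /interior.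
by exists (A, B) => //=; split; [exact: oA|exact: oB].
Qed.

Let contX (S T S' T' : topologicalType) (f : S -> S') (g : T -> T')
    (x : S * T) : {for x.1, continuous f} -> {for x.2, continuous g} ->
  {for x, continuous (fun z : S * T => (f z.1, g z.2))}.
Proof.
move=> cf cg; apply: cvg_pair => /=.
- exact: (@cvg_comp _ _ _ fst f _ _ _ cvg_fst cf).
- exact: (@cvg_comp _ _ _ snd g _ _ _ cvg_snd cg).
Qed.

Let dom_open : open dom.
Proof. by apply: openX; exact: chart_dom_open. Qed.

Let img_open : open img.
Proof. by apply: openX; exact: chart_img_open. Qed.

Let fwd_img x : dom x -> img (fwd x).
Proof. by case=> ? ?; split; exact: chart_fun_img. Qed.

Let bwd_dom u : img u -> dom (bwd u).
Proof. by case=> ? ?; split; exact: chart_inv_dom. Qed.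

Let fwdK x : dom x -> bwd (fwd x) = x.
Proof. by case: x => x y [/= ? ?]; rewrite /bwd /= !chart_funK. Qed.

Let bwdK u : img u -> fwd (bwd u) = u.
Proof. by case: u => u v [/= ? ?]; rewrite /fwd /= !chart_invK. Qed.

Let fwd_continuous x : dom x -> {for x, continuous fwd}.
Proof. by case=> ? ?; apply: contX; exact: chart_fun_continuous. Qed.

Let bwd_continuous u : img u -> {for u, continuous bwd}.
Proof. by case=> ? ?; apply: contX; exact: chart_inv_continuous. Qed.

Definition prod_chart : chart (V * W)%type (M * N)%type :=
  Chart dom_open img_open fwd_img bwd_dom fwdK bwdK
        fwd_continuous bwd_continuous.

End ProductChart.

Definition prod_atlas (R : realType) (V W : normedModType R)
    (M N : topologicalType) (A : set (chart V M)) (B : set (chart W N)) :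
    set (chart (V * W)%type (M * N)%type) :=
  [set prod_chart c d | c in A & d in B].

HB.mixin Record isLieGroup (R : realType) (n : nat) (G : Type)
    of Group G & Topological G := {
  lie_hausdorff : hausdorff_space G;
  lie_atlas : set (chart 'rV[R]_n G);
  lie_atlasP : smooth_atlas lie_atlas;
  lie_mul_smooth : smooth_map (prod_atlas lie_atlas lie_atlas) lie_atlas
    (fun x : G * G => (x.1 * x.2)%g);
  lie_inv_smooth : smooth_map lie_atlas lie_atlas (fun x : G => (x^-1)%g)
}.

#[short(type="lieGroupType")]
HB.structure Definition LieGroup (R : realType) (n : nat) :=
  {G of Group G & Topological G & isLieGroup R n G}.

Definition identity_component (R : realType) (n : nat)
    (G : lieGroupType R n) : set G := connected_component [set: G] 1%g.
Arguments identity_component {R n} G.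

Definition left_cosets (G : groupType) (H : set G) : set (set G) :=
  range (fun g : G => [set (g * h)%g | h in H]).

Definition is_subgroup (G : groupType) (H : set G) : Prop :=
  H 1%g /\ (forall x y, H x -> H y -> H (x / y)%g).

Definition finitely_generated (G : groupType) : Prop :=
  exists2 S : set G, finite_set S & smallest (@is_subgroup G) S = [set: G].

(* Main.v *)
(* Let N be the kernel of phi.  The velocities at 1 of the C^1 curves contained
   in N form an Ad(G)-invariant subspace I of the Lie algebra.

   If q is the inverse of a chart at 1 and n is in N, the curve t |-> [q(t x), n]
   lies in N, so x - Ad(n) x is in I.
   Hence g |-> Ad(g) x mod I factors through the countable group Gamma; along a
   path from 1 it is continuous with countable range, so it is constant.  Thus
   Ad(g) x - x is in I for g near 1, and every curve t |-> [g(t), y] near 1 is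
   everywhere tangent to the right-invariant distribution defined by I.

   Multiplying curves in N whose velocities span I gives a map F from I to N,
   and F(u) q(v), with v in a complement of I, are local coordinates on G.  The
   v-coordinate of a curve tangent to the distribution has zero derivative, so
   such a curve starting at 1 stays in N.  Therefore commutators of elements
   near 1 are in N, and phi(G^0) is abelian.

   The m-th power map of G is open at 1, so phi(G^0) is divisible; it has finite
   index in Gamma, so it is finitely generated (Schreier).  A finitely generated
   divisible abelian group is trivial, so N contains the open subgroup G^0.

   Derivatives are taken in the strict sense, f y - f z = L (y - z) + o(y - z)
   as y and z both tend to x: this is a pointwise condition, stable under
   composition, and it is what the contraction principle needs. *)

From HB Require Import structures.
Require Import Defs.
From mathcomp Require Import all_boot all_order all_algebra.
From mathcomp Require Import all_classical all_reals all_analysis.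
From mathcomp Require Import ring lra.
Import Order.TTheory GRing.Theory Num.Theory.
Import numFieldNormedType.Exports.

Set Implicit Arguments.
Unset Strict Implicit.
Unset Printing Implicit Defensive.

Local Open Scope classical_set_scope.
Local Open Scope ring_scope.

(** * Strict differentiability *)

(** Boundedness is part of the notion because a linear map between arbitrary normed modules need not
    be continuous. *)
Definition bounded_linear (R : realType) (V W : normedModType R) (L : V -> W) :=
  linear L /\ exists2 C : R, 0 <= C & forall v, `|L v| <= C * `|v|.

Definition sdiff (R : realType) (V W : normedModType R)
    (f : V -> W) (x : V) (L : V -> W) :=
  bounded_linear L /\
  forall e : R, 0 < e -> exists2 A, nbhs x A &
    forall y z, A y -> A z -> `|f y - f z - L (y - z)| <= e * `|y - z|.

Lemma le0_of_le_eps (R : realType) (a b : R) :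
  (forall e, 0 < e -> a <= e * b) -> a <= 0.
Proof.
move=> h; rewrite leNgt; apply/negP => a0.
have b0 : 0 < `|b| + 1 by rewrite ltr_wpDl.
have := h (a / 2 / (`|b| + 1)); rewrite !divr_gt0// => /(_ isT).
rewrite leNgt => /negP; apply.
rewrite mulrAC ltr_pdivrMr// -mulrA ltr_pM2l//.
have := ler_norm b; have := normr_ge0 b; lra.
Qed.

Section BoundedLinear.
Context (R : realType) (V W Z : normedModType R).
Implicit Types (L : V -> W).

Lemma blD L x y : bounded_linear L -> L (x + y) = L x + L y.
Proof. by case=> lL _; have := lL 1 x y; rewrite !scale1r. Qed.

Lemma bl0 L : bounded_linear L -> L 0 = 0.
Proof. by move=> bL; apply: (addrI (L 0)); rewrite -blD// !addr0. Qed.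

Lemma blZ L a x : bounded_linear L -> L (a *: x) = a *: L x.
Proof.
by move=> bL; case: (bL) => lL _; have := lL a x 0; rewrite !addr0 bl0// addr0.
Qed.

Lemma blN L x : bounded_linear L -> L (- x) = - L x.
Proof. by move=> bL; rewrite -scaleN1r blZ// scaleN1r. Qed.

Lemma blB L x y : bounded_linear L -> L (x - y) = L x - L y.
Proof. by move=> bL; rewrite blD// blN. Qed.

Lemma bl_comp L (K : W -> Z) :
  bounded_linear L -> bounded_linear K -> bounded_linear (K \o L).
Proof.
move=> [lL [C C0 hC]] [lK [D D0 hD]]; split.
  by move=> a u v /=; rewrite lL lK.
exists (D * C) => [|v /=]; first exact: mulr_ge0.
by rewrite (le_trans (hD _))// -mulrA ler_wpM2l.
Qed.

End BoundedLinear.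

Lemma bl_sub (R : realType) (V W : normedModType R) (L K : V -> W) :
  bounded_linear L -> bounded_linear K -> bounded_linear (fun v => L v - K v).
Proof.
move=> [lL [C C0 hC]] [lK [D D0 hD]]; split.
  by move=> a u v; rewrite lL lK scalerBr opprD addrACA.
exists (C + D) => [|v]; first exact: addr_ge0.
by rewrite (le_trans (ler_normB _ _))// mulrDl lerD.
Qed.

Section Sdiff.
Context (R : realType).
Implicit Types V W Z : normedModType R.

Lemma sdiff_bl V W (f : V -> W) x L : sdiff f x L -> bounded_linear L.
Proof. by case. Qed.

Lemma sdiff_linear V W (L : V -> W) x : bounded_linear L -> sdiff L x L.
Proof.
move=> bL; split=> // e e0; exists setT; first exact: filterT.
by move=> y z _ _; rewrite (blB y z bL) subrr normr0 mulr_ge0// ltW.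
Qed.

Lemma bl_id V : bounded_linear (@idfun V).
Proof. by split=> //; exists 1 => // v; rewrite mul1r. Qed.

Lemma bl_cst0 V W : bounded_linear (fun _ : V => 0 : W).
Proof.
split; first by move=> a u v; rewrite scaler0 addr0.
by exists 0 => // v; rewrite normr0 mul0r.
Qed.

Lemma sdiff_cst V W (a : W) (x : V) : sdiff (fun=> a) x (fun=> 0).
Proof.
split; first exact: bl_cst0.
move=> e e0; exists setT; first exact: filterT.
by move=> y z _ _; rewrite !subrr normr0 mulr_ge0// ltW.
Qed.

Lemma sdiff_ext V W (f g : V -> W) x L :
  (\forall y \near x, f y = g y) -> sdiff f x L -> sdiff g x L.
Proof.
move=> fg [bL h]; split=> // e /h[A xA hA].
exists (A `&` [set y | f y = g y]); first exact: filterI.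
by move=> y z [Ay /= <-] [Az /= <-]; exact: hA.
Qed.

Lemma sdiff_lip V W (f : V -> W) x L : sdiff f x L ->
  exists2 C : R, 0 < C & exists2 A, nbhs x A &
    forall y z, A y -> A z -> `|f y - f z| <= C * `|y - z|.
Proof.
move=> [[lL [C C0 hC]] /(_ 1 ltr01)[A xA hA]].
exists (1 + C); first by rewrite ltr_wpDr.
exists A => // y z Ay Az.
rewrite -(subrK (L (y - z)) (f y - f z)) (le_trans (ler_normD _ _))//.
by rewrite mulrDl lerD// hA.
Qed.

Lemma sdiff_continuous V W (f : V -> W) x L : sdiff f x L ->
  {for x, continuous f}.
Proof.
move=> /sdiff_lip[C C0 [A xA hA]]; have xA' := xA.
apply/cvgrPdist_le => e e0.
have d0 : 0 < e / C by rewrite divr_gt0.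
have xd : \forall y \near x, `|x - y| <= e / C.
  by apply: cvgr_dist_le => //; exact: cvg_id.
apply: filterS2 xA xd => y Ay xy.
rewrite (le_trans (hA _ _ (nbhs_singleton xA') Ay))//.
by rewrite mulrC -ler_pdivlMr.
Qed.

Lemma sdiff_comp V W Z (f : V -> W) (g : W -> Z) x L K :
  sdiff f x L -> sdiff g (f x) K -> sdiff (g \o f) x (K \o L).
Proof.
move=> sf sg; have [C C0 [A xA hA]] := sdiff_lip sf.
have cf := sdiff_continuous sf.
have [bL hL] := sf; have [bK hK] := sg.
have [_ [D D0 hD]] := bK.
split=> [|e e0]; first exact: bl_comp.
have D1 : 0 < D + 1 by rewrite ltr_wpDl.
(* The error of [g \o f] is the error of [g] at [f y], [f z] plus [K] applied to the error of [f].
   Dividing by the Lipschitz constant [C] of [f] and by the bound [D + 1] of [K] makes each cost at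
   most [e / 2]. *)
have [B xB hB] := hK (e / 2 / C) (divr_gt0 (divr_gt0 e0 (ltr0Sn _ 1)) C0).
have [E xE hE] := hL (e / 2 / (D + 1)) (divr_gt0 (divr_gt0 e0 (ltr0Sn _ 1)) D1).
exists (A `&` E `&` f @^-1` B).
  by apply: filterI; [exact: filterI|exact: cf].
move=> y z [[Ay Ey] By] [[Az Ez] Bz] /=.
have -> : g (f y) - g (f z) - K (L (y - z)) =
   (g (f y) - g (f z) - K (f y - f z)) + K (f y - f z - L (y - z)).
  by rewrite (blB (f y - f z))// addrA subrK.
rewrite (le_trans (ler_normD _ _))//.
have -> : e * `|y - z| = e / 2 * `|y - z| + e / 2 * `|y - z|.
  by rewrite -mulrDl -splitr.
apply: lerD.
  rewrite (le_trans (hB _ _ By Bz))//.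
  rewrite (le_trans (ler_wpM2l _ (hA _ _ Ay Az)))//.
    by rewrite !divr_ge0 ?ltW.
  by rewrite mulrA divfK ?gt_eqF.
rewrite (le_trans (hD _))// (le_trans (ler_wpM2l D0 (hE _ _ Ey Ez)))//.
rewrite mulrA ler_wpM2r// mulrCA; apply: ler_piMr.
  by rewrite divr_ge0// ltW.
by rewrite ler_pdivrMr// mul1r lerDl.
Qed.

Lemma sdiff_pair V W Z (f : V -> W) (g : V -> Z) x L K :
  sdiff f x L -> sdiff g x K ->
  sdiff (fun v => (f v, g v)) x (fun v => (L v, K v)).
Proof.
move=> [[lL [C C0 hC]] hL] [[lK [D D0 hD]] hK]; split.
  split=> [a u v|]; first by rewrite lL lK.
  exists (C + D) => [|v]; first exact: addr_ge0.
  rewrite prod_normE/= ge_max mulrDl (le_trans (hC v)) ?(le_trans (hD v))//.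
    by rewrite lerDr mulr_ge0.
  by rewrite lerDl mulr_ge0.
move=> e e0; have [A xA hA] := hL _ e0; have [B xB hB] := hK _ e0.
exists (A `&` B); first exact: filterI.
move=> y z [Ay By] [Az Bz].
by rewrite prod_normE/= ge_max hA//= hB.
Qed.

Lemma bl_fst V W : bounded_linear (@fst V W).
Proof.
split; first by move=> a [u v] [u' v'].
by exists 1 => // -[u v]; rewrite mul1r [leRHS]prod_normE/= le_max lexx.
Qed.

Lemma bl_snd V W : bounded_linear (@snd V W).
Proof.
split; first by move=> a [u v] [u' v'].
by exists 1 => // -[u v]; rewrite mul1r [leRHS]prod_normE/= le_max lexx orbT.
Qed.

Lemma bl_scale V (xi : V) : bounded_linear (fun t : R^o => t *: xi).
Proof.
split; first by move=> a u v; rewrite scalerDl scalerA.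
by exists `|xi| => // t; rewrite normrZ mulrC.
Qed.

(** Both derivatives approximate the same increment from [x] to [x + t *: v] for one small [t > 0];
    dividing by [t] leaves [L v - K v] arbitrarily small. *)
Lemma sdiff_unique V W (f : V -> W) x L K :
  sdiff f x L -> sdiff f x K -> L = K.
Proof.
move=> [bL hL] [bK hK]; apply/funext => v; apply/eqP; rewrite -subr_eq0.
rewrite -normr_le0; apply: (@le0_of_le_eps _ _ (`|v| + `|v|)) => e e0.
have [A xA hA] := hL _ e0; have [B xB hB] := hK _ e0.
have [t t0 [At Bt]] : exists2 t : R, 0 < t & A (x + t *: v) /\ B (x + t *: v).
  have : nbhs x (A `&` B) by exact: filterI.
  move=> /nbhs_normP[r /= r0 hr]; exists (r / (`|v| + 1)).
    by rewrite divr_gt0// ltr_wpDl.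
  apply: hr => /=; rewrite opprD addrA subrr sub0r normrN normrZ.
  have v0 : 0 < `|v| + 1 by rewrite ltr_wpDl.
  rewrite ger0_norm ?divr_ge0 ?ltW// mulrAC ltr_pdivrMr//.
  by rewrite ltr_pM2l// ltrDl.
have Ax := nbhs_singleton xA; have Bx := nbhs_singleton xB.
have e1 : x + t *: v - x = t *: v by rewrite addrC addKr.
have := hA _ _ At Ax; have := hB _ _ Bt Bx; rewrite e1 (blZ t v bL) (blZ t v bK) => h1 h2.
rewrite -(ler_pM2l t0) -[t in t * `|_|](ger0_norm (ltW t0)) -normrZ scalerBr.
have -> : t *: L v - t *: K v = (f (x + t *: v) - f x - t *: K v) -
    (f (x + t *: v) - f x - t *: L v).
  by rewrite opprB [RHS]addrC addrA subrK.
rewrite (le_trans (ler_normB _ _))// mulrCA !mulrDr.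
by move: h1 h2; rewrite normrZ (ger0_norm (ltW t0)) => h1 h2; rewrite lerD.
Qed.

End Sdiff.

(** * Local inversion by the contraction principle *)

HB.instance Definition _ (R : realType) (m n : nat) :=
  Uniform_isComplete.Build 'M[R]_(m, n) cauchy_cvg.

(** Strictness makes [f - id] a contraction of ratio 1/2 near 0, so the equation [f w = x] is the
    fixed-point equation of [w |-> x - (f w - w)]. The constant 2 is 1 / (1 - 1/2). *)
Lemma local_right_inverse (R : realType) (V : completeNormedModType R)
    (f : V -> V) : f 0 = 0 -> sdiff f 0 idfun ->
  exists2 d : R, 0 < d & exists g : V -> V,
    forall x, `|x| < d -> [/\ f (g x) = x, `|g x| <= 2 * `|x| &
      forall y, `|y| < d -> `|g x - g y| <= 2 * `|x - y|].
Proof.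
move=> f0 [_ /(_ (1/2))]; rewrite divr_gt0// => /(_ isT)[A].
move=> /nbhs_normP[r /= r0 hr] hA.
pose U : set V := closed_ball_ Num.norm 0 (r / 2).
have UE w : U w = (`|w| <= r / 2) :> Prop by rewrite /U/closed_ball_/= sub0r normrN.
have U0 : U 0 by rewrite UE normr0 divr_ge0// ltW.
have hball w z : U w -> U z ->
    `|f w - f z - (w - z)| <= 1 / 2 * `|w - z|.
  rewrite !UE => wr zr; apply: hA; apply: hr => /=; rewrite sub0r normrN; lra.
(* The ball of radius [r / 2] is preserved because r/4 + (1/2)(r/2) = r/2. *)
have ex x : `|x| < r / 4 -> exists2 w, U w & f w = x.
  move=> xr; pose T := fun w => x - (f w - w).
  have TU : {homo T : w / U w >-> U w}.
    move=> w Uw; rewrite UE /T (le_trans (ler_normB _ _))//.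
    have := hball w 0 Uw U0; rewrite f0 !subr0; rewrite UE in Uw; lra.
  have cT : is_contraction (mkfun_fun TU).
    exists (1 / 2)%:nng; split => /=; first by lra.
    move=> [w z] /= [Uw Uz]; rewrite /mkfun/= /T.
    have -> : x - (f w - w) - (x - (f z - z)) = - (f w - f z - (w - z)).
      rewrite [LHS]addrC opprB subrKA opprB [RHS]opprB opprB.
      by rewrite addrACA (addrC (f z)) addrACA.
    by rewrite normrN; exact: hball.
  have [] := banach_fixed_point cT; first exact: closed_closed_ball_.
    by exists 0.
  move=> w Uw; rewrite /mkfun_fun/= /mkfun /T => ww; exists w => //.
  move: ww; rewrite opprB addrCA -[X in X = _]addr0 => /addrI/esym/eqP.
  by rewrite subr_eq0 => /eqP.
exists (r / 4); first by rewrite divr_gt0.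
have [|g hg] := @choice _ _ (fun x y => `|x| < r / 4 -> U y /\ f y = x).
  move=> x; have [/ex[w Uw fw]|] := boolP (`|x| < r / 4); first by exists w.
  by exists 0.
have lip x y : `|x| < r / 4 -> `|y| < r / 4 -> `|g x - g y| <= 2 * `|x - y|.
  move=> /hg[Ux fx] /hg[Uy fy]; have := hball _ _ Ux Uy; rewrite fx fy.
  have : `|g x - g y| <= `|x - y - (g x - g y)| + `|x - y|.
    by rewrite -{1}(subKr (x - y) (g x - g y)) [leRHS]addrC ler_normB.
  lra.
exists g => x xr; have [Ux fx] := hg _ xr; split => //; last by move=> y; exact: lip.
have := hball _ _ Ux U0; rewrite fx f0 !subr0.
have : `|g x| <= `|x - g x| + `|x|.
  by rewrite -{1}(subKr x (g x)) [leRHS]addrC ler_normB.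
lra.
Qed.

(** * The mean value inequality, and strict differentiability of C^1 maps *)

Section MeanValue.
Context (R : realType).

Lemma is_derive_eps (g : R -> R) (t d : R) :
  (forall e : R, 0 < e ->
    \forall s \near t, `|g s - g t - d * (s - t)| <= e * `|s - t|) ->
  is_derive t 1 g d.
Proof.
move=> h; suff c : (fun u : R => u^-1 *: ((g \o shift t) (u *: (1 : R)) - g t))
    @ 0^' --> d.
  by apply: DeriveDef; [apply/cvg_ex; exists d|exact: cvg_lim].
apply/cvgrPdist_le => e e0; rewrite near_withinE.
have : \forall u \near (0 : R), `|g (u + t) - g t - d * u| <= e * `|u|.
  have ct : (fun u : R => u + t) @ 0 --> t.
    by rewrite -[X in _ --> X]add0r; apply: cvgD; [exact: cvg_id|exact: cvg_cst].
  have /ct := h e e0; rewrite /nbhs/= => hu; near=> u.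
  by rewrite -[X in _ * X](addrK t) -[X in _ <= _ * `|X|](addrK t); near: u.
apply: filterS => u /= hu u0.
rewrite -(ler_pM2r (_ : 0 < `|u|)) ?normr_gt0// -normrM /GRing.scale/= mulr1.
by rewrite mulrBl mulrAC mulVf// mul1r distrC.
Unshelve. all: by end_near. Qed.

Lemma rV_norm_ge n (v : 'rV[R]_n) j : `|v 0 j| <= `|v|.
Proof.
rewrite [leRHS]/Num.norm/= mx_normrE.
by apply/bigmax_geP; right => /=; exists (0, j).
Qed.

Lemma rV_norm_le n (v : 'rV[R]_n) (M : R) : 0 <= M ->
  (forall j, `|v 0 j| <= M) -> `|v| <= M.
Proof.
move=> M0 h; rewrite [leLHS]/Num.norm/= mx_normrE; apply/bigmax_leP; split => //.
by move=> [i j] _ /=; rewrite ord1.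
Qed.

(** The norm of row vectors is the maximum of the coordinates, so the scalar mean value theorem
    applied to each coordinate loses no constant. *)
Lemma mean_value_bound n (g d : R -> 'rV[R]_n) (M : R) :
  (forall t : R, 0 <= t <= 1 -> forall e : R, 0 < e ->
    \forall s \near t, `|g s - g t - (s - t) *: d t| <= e * `|s - t|) ->
  (forall t : R, 0 <= t <= 1 -> `|d t| <= M) -> `|g 1 - g 0| <= M.
Proof.
move=> hg hd.
have M0 : 0 <= M by apply: le_trans (hd 0 _); rewrite ?lexx ?ler01.
apply: rV_norm_le => // j.
have der (t : R) : 0 <= t <= 1 -> is_derive t 1 (fun s => g s 0 j) (d t 0 j).
  move=> t01; apply: is_derive_eps => e e0.
  apply: filterS (hg t t01 e e0) => s; apply: le_trans.
  have -> : g s 0 j - g t 0 j - d t 0 j * (s - t) =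
    (g s - g t - (s - t) *: d t) 0 j by rewrite !mxE mulrC.
  exact: rV_norm_ge.
have [t|t|c c01 ] := @MVT R (fun s => g s 0 j) (fun s => d s 0 j) 0 1 ltr01.
- by rewrite in_itv/= => /andP[/ltW t0 /ltW t1]; apply: der; rewrite t0.
- apply: derivable_within_continuous => {}t; rewrite in_itv/= => t01.
  exact: (@ex_derive _ _ _ _ _ _ _ (der t t01)).
rewrite subr0 mulr1 => E; have -> : (g 1 - g 0) 0 j = d c 0 j by rewrite !mxE.
move: c01; rewrite in_itv/= => /andP[/ltW t0 /ltW t1].
by rewrite (le_trans (rV_norm_ge _ _))// hd// t0.
Qed.

End MeanValue.

(** Finite dimension, encoded so that it passes to products without identifying them with spaces of
    row vectors, and with coordinate functions that are bounded by definition. *)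
Definition finite_frame (R : realType) (V : normedModType R) :=
  exists (I : finType) (e : I -> V) (a : I -> V -> R^o),
    (forall i, bounded_linear (a i)) /\ forall v, v = \sum_i a i v *: e i.

Lemma finite_frame_rV (R : realType) n : finite_frame 'rV[R]_n.
Proof.
exists 'I_n, (fun i => delta_mx 0 i), (fun i (v : 'rV[R]_n) => v 0 i).
split=> [i|v]; last exact: row_sum_delta.
split; first by move=> c u v; rewrite !mxE.
by exists 1 => // v; rewrite mul1r rV_norm_ge.
Qed.

Lemma finite_frame_prod (R : realType) (V W : normedModType R) :
  finite_frame V -> finite_frame W -> finite_frame (V * W)%type.
Proof.
move=> [I [e [a [ha h]]]] [J [f [b [hb k]]]].
exists (I + J)%type, (fun s => match s with inl i => (e i, 0) | inr j => (0, f j) end),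
  (fun s v => match s with inl i => a i v.1 | inr j => b j v.2 end); split.
  case=> [i|j]; first exact: (bl_comp (bl_fst _ _) (ha i)).
  exact: (bl_comp (bl_snd _ _) (hb j)).
move=> v; rewrite big_sumType/=; have h1 := h v.1; have k1 := k v.2.
transitivity ((v.1, 0) + (0, v.2) : V * W).
  by rewrite [LHS]surjective_pairing; congr pair; rewrite /= ?addr0 ?add0r.
congr (_ + _); rewrite [RHS]surjective_pairing; congr pair.
all: rewrite ?(raddf_sum (@fst V W)) ?(raddf_sum (@snd V W))/=.
- exact: h1.
- by rewrite big1// => i _; rewrite scaler0.
- by rewrite big1// => i _; rewrite scaler0.
- exact: k1.
Qed.

Lemma differentiable_eps (R : realType) (V W : normedModType R) (f : V -> W) x :
  differentiable f x -> forall e : R, 0 < e ->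
  \forall y \near x, `|f y - f x - 'd f x (y - x)| <= e * `|y - x|.
Proof.
move=> /diff_locally/eqaddoP h e e0; have {h} := h e e0 => h.
have cx : (fun y : V => y - x) @ x --> (0 : V).
  by rewrite -[X in _ --> X](subrr x); apply: cvgB; [exact: cvg_id|exact: cvg_cst].
have := cx _ h; rewrite /nbhs/=; apply: filterS => y /=.
rewrite opprD addrA.
rewrite -![(_ + _ : _ -> _) _]/(_ + _) -![(- _ : _ -> _) _]/(- _) /cst /= subrK.
by [].
Qed.

(** The mean value inequality on the segment from [z] to [y], applied to [f] minus its derivative at
    [x], turns continuity of the derivative into the strict estimate. [Ck_on] gives this continuity
    one vector at a time; the frame makes it uniform. *)
Lemma sdiff_of_C1 (R : realType) (V : normedModType R) n (U : set V)
    (f : V -> 'rV[R]_n) x :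
  finite_frame V -> open U -> U x -> Ck_on 1 U f -> sdiff f x ('d f x).
Proof.
move=> [I [b [a [ha fr]]]] oU Ux [df cf].
have [|c hc] := @choice _ _ (fun i C => 0 <= C /\ forall v, `|a i v| <= C * `|v|).
  by move=> i; have [_ [C C0 hC]] := ha i; exists C.
pose C := \sum_i c i; have C0 : 0 <= C by rewrite sumr_ge0// => i _; exact: (hc i).1.
have frC v i : `|a i v| <= C * `|v|.
  rewrite (le_trans ((hc i).2 v))// ler_wpM2r// /C (bigD1 i)//= lerDl.
  by rewrite sumr_ge0// => j _; exact: (hc j).1.
(* A linear map is bounded in norm by its values on the frame. *)
have bound (W : normedModType R) (L : V -> W) M : linear L -> 
    (forall i, `|L (b i)| <= M) -> forall v, `|L v| <= (#|I|%:R * C * M) * `|v|.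
  move=> lL hM v; have bL a' u w : L (a' *: u + w) = a' *: L u + L w by exact: lL.
  have L0 : L 0 = 0.
    have := bL 1 0 0; rewrite !scale1r addr0 => /(congr1 (fun u => u - L 0)).
    by rewrite addrK subrr.
  have -> : L v = \sum_i a i v *: L (b i).
    rewrite [in LHS](fr v); elim/big_rec2: _ => [//|i y z _ <-].
    exact: bL.
  rewrite (le_trans (ler_norm_sum _ _ _))//.
  rewrite (@le_trans _ _ (\sum_(i : I) (C * `|v| * M)))//.
    by apply: ler_sum => i _; rewrite normrZ ler_pM.
  by rewrite sumr_const -mulr_natl le_eqVlt; apply/orP; left; apply/eqP; ring.
have lin y : linear ('d f y) by move=> k u w; rewrite linearP.
split.
  split; first exact: lin.
  exists (#|I|%:R * C * \sum_i `|'d f x (b i)|).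
    by rewrite !mulr_ge0// sumr_ge0.
  apply: bound => // i; rewrite (bigD1 i)//= lerDl sumr_ge0//.
move=> e e0.
pose K := #|I|%:R * C + 1.
have K0 : 0 < K by rewrite ltr_wpDl// mulr_ge0.
have : \forall y \near x, U y /\ forall i, `|'d f y (b i) - 'd f x (b i)| <= e / K.
  apply: filterI; first exact: open_nbhs_nbhs.
  have : \forall y \near x, forall i : I, setT i ->
      `|'d f y (b i) - 'd f x (b i)| <= e / K.
    apply: filter_forall => // i.
    have /cvgrPdist_le := cf (b i) x Ux => /(_ (e / K)).
    rewrite divr_gt0// => /(_ isT); apply: filterS => y; by rewrite distrC.
  by apply: filterS => y h i; exact: h.
move=> /nbhs_normP[r /= r0 hr]; exists (ball_ Num.norm x r).
  by apply/nbhs_normP; exists r.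
move=> y z /= xy xz.
pose w t := z + t *: (y - z).
have wr t : 0 <= t <= 1 -> `|x - w t| < r.
  move=> /andP[t0 t1].
  have -> : x - w t = (1 - t) *: (x - z) + t *: (x - y).
    rewrite scalerBl scale1r -addrA (addrC (- _)) -scalerBr opprB.
    by rewrite (addrC (x - y)) subrKA /w opprD addrA -scalerN opprB.
  rewrite (le_lt_trans (ler_normD _ _))// !normrZ !ger0_norm ?subr_ge0//.
  (* Strictness of the convexity estimate comes from the term with factor [t], so the endpoint
     [t = 0] is treated apart. *)
  move: t0; rewrite le_eqVlt => /predU1P[<-|t0].
    by rewrite subr0 mul1r mul0r addr0.
  rewrite (_ : r = (1 - t) * r + t * r); last by rewrite -mulrDl subrK mul1r.
  by rewrite ler_ltD// ?ltr_pM2l// ler_wpM2l ?subr_ge0// ltW.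
(* Subtracting the linear part makes [g 1 - g 0] the error to be estimated. *)
pose g t := f (w t) - t *: 'd f x (y - z).
have := @mean_value_bound _ _ g
  (fun t => 'd f (w t) (y - z) - 'd f x (y - z)) (e * `|y - z|).
rewrite /g /w !scale1r !scale0r subr0 addr0 subrKC => mv.
rewrite addrAC; apply: mv => t t01; last first.
  have [_ hb] := hr _ (wr _ t01).
  apply: (@le_trans _ _ ((#|I|%:R * C * (e / K)) * `|y - z|)).
    apply: (bound _ (fun v => 'd f (w t) v - 'd f x v)) => // k u v.
    by rewrite (linearP ('d f (w t))) (linearP ('d f x)) scalerBr opprD addrACA.
  rewrite ler_wpM2r// mulrCA; apply: ler_piMr; first exact: ltW.
  by rewrite ler_pdivrMr// mul1r lerDl.
move=> d d0; have [/df dw _] := hr _ (wr _ t01).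
have d1 : 0 < d / (`|y - z| + 1) by rewrite divr_gt0// ltr_wpDl.
have cw : w s @[s --> t] --> w t.
  apply: cvgD; first exact: cvg_cst.
  by apply: cvgZ; [exact: cvg_id|exact: cvg_cst].
apply: (@filterS _ (nbhs t) _ _ _ _ (cw _ (differentiable_eps dw d1))) => s /=.
have -> : w s - w t = (s - t) *: (y - z) by rewrite /w opprD addrACA subrr add0r scalerBl.
rewrite linearZ/= normrZ => h.
rewrite [X in `|X|](_ : _ = f (w s) - f (w t) - (s - t) *: 'd f (w t) (y - z)).
  rewrite (le_trans h)// mulrCA mulrC ler_wpM2r//.
  rewrite mulrAC ler_pdivrMr ?ltr_wpDl//.
  by apply: ler_wpM2l; [exact: ltW|rewrite lerDl].
rewrite (opprD (f _)) addrACA -opprD -scalerBl.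
rewrite (scalerBr _ ('d f (w t) _)) opprB addrA subrK.
by rewrite /w.
Qed.

(** * Differential calculus for group-valued maps *)

Lemma sdiff_near (R : realType) (V W : normedModType R) (f : V -> W) x y L
    (P : set W) :
  sdiff f x L -> f x = y -> (\forall z \near y, P z) -> \forall u \near x, P (f u).
Proof. by move=> /sdiff_continuous cf <- /cf. Qed.

Section LocalCoordinates.
Context (R : realType) (V : normedModType R) (G : groupType).

(* [q] is the inverse of a chart around [1], centred at [0]. *)
Record local_coordinates (q : V -> G) : Prop := LocalCoordinates {
  lc_zero : q 0 = 1%g;
  lc_inj : exists2 A, nbhs (0 : V) A &
    forall u v, A u -> A v -> q u = q v -> u = v;
  lc_mul : exists M L, [/\ M 0 = 0, sdiff (M : V * V -> V) 0 L &
    \forall p \near (0 : V * V), (q p.1 * q p.2)%g = q (M p)];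
  lc_inv : exists J L, [/\ J 0 = 0, sdiff (J : V -> V) 0 L &
    \forall x \near (0 : V), ((q x)^-1)%g = q (J x)];
  lc_conj : forall a, exists C L, [/\ C 0 = 0, sdiff (C : V -> V) 0 L &
    \forall x \near (0 : V), (a * q x * a^-1)%g = q (C x)];
  lc_near : \forall v \near (0 : V), exists h L,
    [/\ h v = 0, sdiff (h : V -> V) v L &
      \forall u \near v, q u = (q (h u) * q v)%g] }.

(* [L] is the right logarithmic derivative of [f] at [w]. *)
Definition gdiff (q : V -> G) (W : normedModType R) (f : W -> G) (w : W)
    (L : W -> V) : Prop :=
  exists h : W -> V, [/\ h w = 0, sdiff h w L &
    \forall u \near w, f u = (q (h u) * f w)%g].

Context (q : V -> G) (lc : local_coordinates q).
Implicit Types W Z : normedModType R.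
Local Notation gd := (gdiff q).

Let q0 := lc_zero lc.

Lemma gdiff_bl W (f : W -> G) w L : gd f w L -> bounded_linear L.
Proof. by case=> h [_ /sdiff_bl]. Qed.

(** Injectivity of [q] near 0 forces the two coordinate maps of [f u * (f w)^-1] to agree near
    [w]. *)
Lemma gdiff_unique W (f : W -> G) w L K : gd f w L -> gd f w K -> L = K.
Proof.
move=> [h [h0 sh hf]] [k [k0 sk kf]]; have [A A0 injA] := lc_inj lc.
apply: (sdiff_unique sh); apply: (sdiff_ext _ sk).
have hA : \forall u \near w, A (h u) by exact: sdiff_near sh h0 A0.
have kA : \forall u \near w, A (k u) by exact: sdiff_near sk k0 A0.
near=> u; apply: injA; [by near: u|by near: u|].
by apply: (@mulIg _ (f w)); transitivity (f u); [symmetry; near: u|near: u].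
Unshelve. all: by end_near. Qed.

Lemma gdiff_ext W (f g : W -> G) w L : (\forall u \near w, f u = g u) ->
  gd f w L -> gd g w L.
Proof.
move=> fg [h [h0 sh hf]]; exists h; split => //.
have fgw := nbhs_singleton fg.
near=> u; transitivity (f u); first by symmetry; near: u.
by rewrite -fgw; near: u.
Unshelve. all: by end_near. Qed.

Lemma gdiff_cst W (a : G) (w : W) : gd (fun=> a) w (fun=> 0).
Proof.
exists (fun=> 0); split => //; first exact: sdiff_cst.
by apply: nearW => u; rewrite q0 mul1g.
Qed.

Lemma gdiff_comp W Z (f : W -> G) (k : Z -> W) z L K :
  sdiff k z K -> gd f (k z) L -> gd (f \o k) z (L \o K).
Proof.
move=> sk [h [h0 sh hf]]; exists (h \o k); split => //.
  exact: sdiff_comp sk sh.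
exact: (sdiff_continuous sk) hf.
Qed.

Lemma gdiff_q0 : gd q 0 idfun.
Proof.
exists idfun; split => //; first exact: sdiff_linear (bl_id _).
by apply: nearW => u; rewrite q0 mulg1.
Qed.

(** Over the point [1] the right factor disappears: with [gdiff_of_coord], this reduces [gdiff]
    there to strict differentiability of the coordinate map. *)
Lemma gdiff_one W (f : W -> G) w L : f w = 1%g -> gd f w L ->
  exists h, [/\ h w = 0, sdiff h w L & \forall u \near w, f u = q (h u)].
Proof.
move=> fw [h [h0 sh hf]]; exists h; split => //.
by apply: filterS hf => u ->; rewrite fw mulg1.
Qed.

Lemma gdiff_of_coord W (f : W -> G) w h L : h w = 0 -> sdiff h w L ->
  (\forall u \near w, f u = q (h u)) -> gd f w L.
Proof.
move=> h0 sh hf; exists h; split => //.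
have fw := nbhs_singleton hf; apply: filterS hf => u ->; rewrite (_ : f w = 1%g) ?mulg1//.
by rewrite fw h0.
Qed.

(** On each axis multiplication reduces to [q], whose derivative at 0 is the identity; by uniqueness
    and linearity the derivative of the product is addition. *)
Lemma lc_mulD : exists M, [/\ M 0 = 0,
  sdiff (M : V * V -> V) 0 (fun p => p.1 + p.2) &
  \forall p \near (0 : V * V), (q p.1 * q p.2)%g = q (M p)].
Proof.
have [M [L [M0 sM hM]]] := lc_mul lc; exists M; split => //.
suff -> : (fun p => p.1 + p.2) = L by [].
have bL := sdiff_bl sM.
have s1 : sdiff (fun x : V => (x, 0 : V)) 0 (fun x => (x, 0)).
  exact: sdiff_pair (sdiff_linear _ (bl_id _)) (sdiff_cst _ _).
have s2 : sdiff (fun x : V => (0 : V, x)) 0 (fun x => (0, x)).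
  exact: sdiff_pair (sdiff_cst _ _) (sdiff_linear _ (bl_id _)).
have g1 : gd q 0 (L \o (fun x => (x, 0))).
  apply: (@gdiff_of_coord _ _ _ (M \o (fun x => (x, 0)))) => //.
    exact: sdiff_comp s1 sM.
  have := sdiff_near s1 erefl hM; apply: filterS => u /= <-.
  by rewrite q0 mulg1.
have g2 : gd q 0 (L \o (fun x => (0, x))).
  apply: (@gdiff_of_coord _ _ _ (M \o (fun x => (0, x)))) => //.
    exact: sdiff_comp s2 sM.
  have := sdiff_near s2 erefl hM; apply: filterS => u /= <-.
  by rewrite q0 mul1g.
apply/funext => -[x y] /=.
have -> : (x, y) = (x, 0) + (0, y) :> V * V.
  by congr pair; rewrite /= ?addr0 ?add0r.
rewrite (blD _ _ bL).
have /(congr1 (@^~ x))/= <- := gdiff_unique gdiff_q0 g1.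
by have /(congr1 (@^~ y))/= <- := gdiff_unique gdiff_q0 g2.
Qed.

Lemma Ad_exists (a : G) : exists L, gd (fun x => (a * q x * a^-1)%g) 0 L.
Proof.
have [C [L [C0 sC hC]]] := lc_conj lc a; exists L.
exact: gdiff_of_coord sC hC.
Qed.

(** The adjoint representation. The choice of [L] is unambiguous by [gdiff_unique]. *)
Definition Ad (a : G) : V -> V := sval (cid (Ad_exists a)).

Lemma AdP (a : G) : gd (fun x => (a * q x * a^-1)%g) 0 (Ad a).
Proof. by rewrite /Ad; case: cid. Qed.

Lemma Ad_bl a : bounded_linear (Ad a).
Proof. exact: gdiff_bl (AdP a). Qed.

Lemma gdiff_conj W (f : W -> G) w a L : f w = 1%g -> gd f w L ->
  gd (fun u => (a * f u * a^-1)%g) w (Ad a \o L).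
Proof.
move=> fw /(gdiff_one fw)[h [h0 sh hf]].
have := AdP a; rewrite -h0 => /(gdiff_comp sh); apply: gdiff_ext.
by apply: filterS hf => u -> /=.
Qed.

(** Moving the increment of [g] to the left across [f w] conjugates it, which produces [Ad (f w)];
    the two increments are then multiplied near [1], where multiplication differentiates to
    addition. *)
Lemma gdiff_mul W (f g : W -> G) w L K : gd f w L -> gd g w K ->
  gd (fun u => (f u * g u)%g) w (fun v => L v + Ad (f w) (K v)).
Proof.
move=> [h [h0 sh hf]] [k [k0 sk kf]].
have [M [M0 sM hM]] := lc_mulD.
have gk : gd (fun u => (f w * q (k u) * (f w)^-1)%g) w (Ad (f w) \o K).
  apply: gdiff_conj; first by rewrite k0 q0.
  by apply: gdiff_of_coord sk _ => //; exact: nearW.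
have [|c [c0 sc hc]] := gdiff_one _ gk; first by rewrite k0 q0 mulg1 mulgV.
have sp := sdiff_pair sh sc; rewrite /= in sp.
have p0 : (h w, c w) = 0 by rewrite h0 c0.
exists (M \o (fun u => (h u, c u))); split.
- by rewrite /= p0.
- have -> : (fun v => L v + Ad (f w) (K v)) =
    (fun p => p.1 + p.2) \o (fun v => (L v, (Ad (f w) \o K) v)) by [].
  by apply: sdiff_comp => //; rewrite p0.
have hMw : \forall u \near w, (q (h u) * q (c u))%g = q (M (h u, c u)).
  exact: (sdiff_near sp p0 hM).
near=> u => /=.
have -> : q (M (h u, c u)) = (q (h u) * q (c u))%g by symmetry; near: u.
have <- : (f w * q (k u) * (f w)^-1)%g = q (c u) by near: u.
have -> : f u = (q (h u) * f w)%g by near: u.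
have -> : g u = (q (k u) * g w)%g by near: u.
by rewrite !mulgA mulgVK.
Unshelve. all: by end_near. Qed.

Lemma gdiff_mull W (f : W -> G) w a L : gd f w L ->
  gd (fun u => (a * f u)%g) w (Ad a \o L).
Proof.
move=> gf; have := gdiff_mul (gdiff_cst a w) gf.
by congr (gd _ _ _); apply/funext => v; rewrite /= add0r.
Qed.

Lemma gdiff_mulr W (f : W -> G) w a L : gd f w L ->
  gd (fun u => (f u * a)%g) w L.
Proof.
move=> gf; have := gdiff_mul gf (gdiff_cst a w).
by congr (gd _ _ _); apply/funext => v; rewrite (bl0 (Ad_bl _)) addr0.
Qed.

Lemma Ad1 v : Ad 1%g v = v.
Proof.
have g1 : gd q 0 (Ad 1%g).
  by apply: gdiff_ext (AdP 1%g); apply: nearW => u; rewrite mul1g divg1.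
by rewrite (gdiff_unique g1 gdiff_q0).
Qed.

Lemma AdM a b v : Ad (a * b)%g v = Ad a (Ad b v).
Proof.
have g1 : gd (fun x => (a * (b * q x * b^-1) * a^-1)%g) 0 (Ad a \o Ad b).
  by apply: gdiff_conj (AdP b); rewrite q0 mulg1 mulgV.
have g2 : gd (fun x => (a * (b * q x * b^-1) * a^-1)%g) 0 (Ad (a * b)%g).
  apply: gdiff_ext (AdP (a * b)%g); apply: nearW => u.
  by rewrite invgM !mulgA.
by rewrite (gdiff_unique g2 g1).
Qed.

Lemma AdKV a v : Ad a^-1%g (Ad a v) = v.
Proof. by rewrite -AdM mulVg Ad1. Qed.

(** [lc_inv] gives only the existence of a derivative; its value is then forced by differentiating
    [f u * (f u)^-1 = 1]. *)
Lemma gdiff_inv W (f : W -> G) w L : gd f w L ->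
  gd (fun u => ((f u)^-1)%g) w (fun v => - Ad (f w)^-1%g (L v)).
Proof.
move=> gf; have [h [h0 sh hf]] := gf.
have [J [K [J0 sJ hJ]]] := lc_inv lc.
have g1 : gd (fun u => (f w * (f u)^-1)%g) w (K \o L).
  apply: (@gdiff_of_coord _ _ _ (J \o h)); first by rewrite /= h0.
    by apply: sdiff_comp sh _; rewrite h0.
  have hJw : \forall u \near w, ((q (h u))^-1)%g = q (J (h u)).
    exact: sdiff_near sh h0 hJ.
  near=> u => /=.
  have <- : ((q (h u))^-1)%g = q (J (h u)) by near: u.
  have -> : f u = (q (h u) * f w)%g by near: u.
  by rewrite invgM mulVKg.
have g2 : gd (fun u => ((f u)^-1)%g) w (Ad (f w)^-1%g \o (K \o L)).
  apply: gdiff_ext (gdiff_mull (f w)^-1%g g1).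
  by apply: nearW => u; rewrite mulKg.
have g3 : gd (fun=> 1%g) w (fun v => L v + Ad (f w) ((Ad (f w)^-1%g \o (K \o L)) v)).
  by apply: gdiff_ext (gdiff_mul gf g2); apply: nearW => u; rewrite mulgV.
have E := gdiff_unique (gdiff_cst 1%g w) g3.
suff <- : Ad (f w)^-1%g \o (K \o L) = (fun v => - Ad (f w)^-1%g (L v)) by [].
apply/funext => v; have /= Ev := congr1 (@^~ v) E.
apply/eqP; rewrite -subr_eq0 opprK addrC.
by rewrite -[X in _ + X](AdKV (f w)) -(blD _ _ (Ad_bl _)) -Ev (bl0 (Ad_bl _)).
Unshelve. all: by end_near. Qed.

Lemma gdiff_near_chart : \forall v \near (0 : V), exists L, gd q v L.
Proof.
apply: filterS (lc_near lc) => v [h [L [h0 sh hq]]].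
by exists L; exists h.
Qed.

End LocalCoordinates.

(** * Translation, scaling, and constancy of real functions *)

Section RealLemmas.
Context (R : realType).

Lemma sdiff_shift (V : normedModType R) (a x : V) :
  sdiff (fun v => v + a) x idfun.
Proof.
split; first exact: bl_id.
move=> e e0; exists setT; first exact: filterT.
move=> y z _ _; rewrite opprD addrACA subrr addr0 subrr normr0.
by rewrite mulr_ge0// ltW.
Qed.

Lemma bl_small (V W : normedModType R) (L : V -> W) (e : R) : bounded_linear L ->
  (\forall x \near 0, `|L x| <= e * `|x|) -> forall x, `|L x| <= e * `|x|.
Proof.
move=> bL /nbhs_normP[r /= r0 hr] x.
have x1 : 0 < `|x| + 1 by rewrite ltr_wpDl.
have t0 : 0 < r / (`|x| + 1) by rewrite divr_gt0.
set k := r / (`|x| + 1) in t0.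
have kr : `|0 - k *: x| < r.
  rewrite sub0r normrN normrZ gtr0_norm// /k mulrAC ltr_pdivrMr//.
  by rewrite ltr_pM2l// ltrDl.
have := hr _ kr; rewrite /= (blZ _ _ bL) (normrZ k (L x)) (normrZ k x).
rewrite (gtr0_norm t0) mulrCA.
by rewrite ler_pM2l.
Qed.

Lemma zero_slope_const (g : R -> R) :
  (forall t : R, 0 <= t <= 1 -> forall e : R, 0 < e ->
    \forall s \near t, `|g s - g t| <= e * `|s - t|) -> g 1 = g 0.
Proof.
move=> hg.
have der (t : R) : 0 <= t <= 1 -> is_derive t 1 g 0.
  move=> t01; apply: is_derive_eps => e e0; apply: filterS (hg t t01 e e0) => s.
  by rewrite mul0r subr0.
have [t|t|c c01 ] := @MVT R g (fun=> 0) 0 1 ltr01.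
- by rewrite in_itv/= => /andP[/ltW t0 /ltW t1]; apply: der; rewrite t0.
- apply: derivable_within_continuous => {}t; rewrite in_itv/= => t01.
  exact: (@ex_derive _ _ _ _ _ _ _ (der t t01)).
by rewrite mul0r => /eqP; rewrite subr_eq0 => /eqP.
Qed.

(** If the end values differed, the intermediate value theorem would put a nondegenerate interval
    inside the range; it has positive Lebesgue measure, whereas a countable set is null. *)
Lemma countable_range_const (g : R -> R) :
  (forall t : R, 0 <= t <= 1 -> {for t, continuous g}) ->
  countable [set g t | t in `[0, 1]] -> g 1 = g 0.
Proof.
move=> cg cnt; apply: contrapT => /eqP g10.
have cw : {within `[0, 1], continuous g}.
  apply: continuous_in_subspaceT => t; rewrite inE/= in_itv/=; exact: cg.
have sub : `[Num.min (g 0) (g 1), Num.max (g 0) (g 1)] `<=` [set g t | t in `[0, 1]].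
  move=> y/=; rewrite in_itv/= => hy.
  by have [t t01 <-] := IVT ler01 cw hy; exists t.
have /countable_lebesgue_measure0 := sub_countable (subset_card_le sub) cnt.
rewrite lebesgue_measure_itv/= lte_fin.
have mM : Num.min (g 0) (g 1) < Num.max (g 0) (g 1).
  move: g10; rewrite neq_lt => /orP[] h.
    by rewrite min_r ?max_l// ltW.
  by rewrite min_l ?max_r// ltW.
rewrite mM -EFinD => -[] /eqP; rewrite subr_eq0 => /eqP E.
by move: mM; rewrite E ltxx.
Qed.

End RealLemmas.

(** * Curves in the kernel *)

Section KernelTangent.
Context (R : realType) (V : completeNormedModType R) (G Gamma : groupType).
Context (q : V -> G) (lc : local_coordinates q).
Context (phi : G -> Gamma) (phiM : {morph phi : x y / (x * y)%g}).
Local Notation gd := (gdiff q).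
Local Notation Ad := (Ad lc).

Lemma morph_one : phi 1%g = 1%g.
Proof. by apply: (@mulgI _ (phi 1%g)); rewrite -phiM !mulg1. Qed.

Lemma morph_inv x : phi x^-1%g = (phi x)^-1%g.
Proof. by apply: (@mulgI _ (phi x)); rewrite -phiM !mulgV morph_one. Qed.

(** Differentiability is required at all parameters near 0, so that a curve can be re-based at its
    nearby points ([ktangent_curve]). The domain is [R^o], the line as a normed module over
    itself. *)
Definition ktangent (xi : V) := exists c : R^o -> G,
  [/\ c 0 = 1%g, gd c 0 (fun t => t *: xi) &
    \forall t \near 0, (exists L, gd c t L) /\ phi (c t) = 1%g].

Lemma bl_line (L : R^o -> V) : bounded_linear L -> 
  L = (fun s => s *: L 1).
Proof.
move=> bL; apply/funext => s; rewrite -(blZ _ _ bL).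
by rewrite /GRing.scale/= mulr1.
Qed.

(** The curve [s |-> c (s + t) * (c t)^-1] lies in the kernel and passes through [1]; right
    translation does not change the right logarithmic derivative. *)
Lemma ktangent_curve (c : R^o -> G) :
  (\forall t \near 0, (exists L, gd c t L) /\ phi (c t) = 1%g) ->
  \forall t \near 0, exists2 xi, ktangent xi & gd c t (fun s => s *: xi).
Proof.
move=> /nbhs_interior; apply: filterS => t ht.
have [[L cL] ct] := nbhs_singleton ht.
have LE := bl_line (gdiff_bl cL).
exists (L 1); last by rewrite -LE.
exists (fun s => c (s + t) * (c t)^-1)%g; split.
- by rewrite add0r mulgV.
- apply: gdiff_mulr => //; rewrite -LE.
  have -> : L = L \o idfun by [].
  apply: (gdiff_comp (sdiff_shift t 0)); by rewrite add0r.
have := sdiff_near (sdiff_shift t (0 : R^o)) (add0r _) ht.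
apply: filterS => s [[K cK] cs]; split; last by rewrite phiM morph_inv cs ct invg1 mulg1.
exists K; apply: gdiff_mulr => //.
have -> : K = K \o idfun by [].
exact: gdiff_comp (sdiff_shift t s) cK.
Qed.

Lemma ktangent0 : ktangent 0.
Proof.
exists (fun=> 1%g); split => //.
  have -> : (fun t : R^o => t *: (0 : V)) = fun=> 0.
    by apply/funext => t; rewrite scaler0.
  exact: gdiff_cst.
apply: (@nearW _ (nbhs (0 : R^o))) => t; split; last exact: morph_one.
by exists (fun=> 0); exact: gdiff_cst.
Qed.

(** Multiplying two kernel curves through [1] adds their velocities, since [Ad 1] is the
    identity. *)
Lemma ktangentD x y : ktangent x -> ktangent y -> ktangent (x + y).
Proof.
move=> [c [c1 dc hc]] [b [b1 db hb]]; exists (fun t => c t * b t)%g; split.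
- by rewrite c1 b1 mulg1.
- have -> : (fun t : R^o => t *: (x + y)) = (fun t : R^o => t *: x + Ad (c 0) (t *: y)).
    by apply/funext => t; rewrite c1 Ad1 scalerDr.
  exact: gdiff_mul.
apply: filterS2 hc hb => t [[L cL] ct] [[K bK] bt]; split.
  by eexists; exact: (gdiff_mul lc cL bK).
by rewrite phiM ct bt mulg1.
Qed.

Lemma ktangentZ a x : ktangent x -> ktangent (a *: x).
Proof.
move=> [c [c1 dc hc]].
have bl : bounded_linear (fun t : R^o => a *: t : R^o).
  split; first by move=> k u v; rewrite scalerDr !scalerA mulrC.
  by exists `|a| => // v; rewrite normrZ.
have sd t := sdiff_linear t bl.
exists (c \o (fun t : R^o => a *: t : R^o)); split.
- by rewrite /= scaler0.
- have -> : (fun t : R^o => t *: (a *: x)) =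
      (fun t : R^o => t *: x) \o (fun t : R^o => a *: t : R^o).
    by apply/funext => t; rewrite /= !scalerA mulrC.
  by apply: gdiff_comp (sd 0) _; rewrite scaler0.
have := sdiff_near (sd 0) (scaler0 _ _) hc.
apply: filterS => t [[L cL] ct]; split => //.
by exists (L \o (fun t : R^o => a *: t : R^o)); exact: gdiff_comp (sd t) cL.
Qed.

Lemma ktangentN x : ktangent x -> ktangent (- x).
Proof. by rewrite -scaleN1r; exact: ktangentZ. Qed.

Lemma ktangent_Ad a x : ktangent x -> ktangent (Ad a x).
Proof.
move=> [c [c1 dc hc]]; exists (fun t => a * c t * a^-1)%g; split.
- by rewrite c1 mulg1 mulgV.
- have -> : (fun t : R^o => t *: Ad a x) = Ad a \o (fun t : R^o => t *: x).
    by apply/funext => t; rewrite /= (blZ _ _ (Ad_bl lc a)).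
  exact: gdiff_conj.
apply: filterS hc => t [[L cL] ct]; split.
  exists (Ad a \o L); apply: gdiff_mulr => //; exact: gdiff_mull.
by rewrite !phiM ct mulg1 morph_inv mulgV.
Qed.

Lemma ktangent_commutator a x : phi a = 1%g -> ktangent (x - Ad a x).
Proof.
move=> pa; pose l := fun t : R^o => t *: x.
have sl (t : R^o) : sdiff l t l by apply: sdiff_linear; exact: bl_scale.
exists (fun t => q (l t) * (a * (q (l t))^-1 * a^-1))%g.
have l0 : l 0 = 0 by rewrite /l scale0r.
have ql0 : q (l 0) = 1%g by rewrite l0 lc_zero.
have dq : gd (q \o l) 0 l.
  have g0 : gd q (l 0) idfun by rewrite l0; exact: gdiff_q0.
  exact: (gdiff_comp (sl 0) g0).
split.
- by rewrite ql0 invg1 !mulg1 mul1g mulgV.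
- have := gdiff_mul lc dq (gdiff_conj lc a _ (gdiff_inv lc dq)).
  rewrite /= ql0 invg1 => /(_ erefl); congr (gdiff _ _ _ _).
  apply/funext => t /=; rewrite !Ad1 /l scalerBr (blN _ (Ad_bl lc a)).
  by rewrite (blZ _ _ (Ad_bl lc a)).
(* Away from [t = 0] only the existence of a derivative of [q] along the line is known, and it is
   all that [ktangent] asks. *)
have := sdiff_near (sl 0) l0 (gdiff_near_chart lc).
apply: filterS => t [L dL]; split.
  have dt : gd (q \o l) t (L \o l) := gdiff_comp (sl t) dL.
  eexists; apply: (gdiff_mul lc dt).
  apply: (gdiff_mulr lc); apply: (gdiff_mull lc); exact: (gdiff_inv lc dt).
by rewrite !phiM pa !morph_inv pa mul1g invg1 mulg1 mulgV.
Qed.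

End KernelTangent.

(** In coordinates [(y, x) |-> q y * q x * (q y)^-1] has strict derivative [(y, x) |-> x] at the
    origin. Strictness allows comparing [(y, x)] with [(y, 0)] for a fixed nonzero [y], so
    conjugation by [q y], and hence its derivative at 0, is close to the identity. *)
Lemma Ad_near1 (R : realType) (V : normedModType R) (G : groupType) (q : V -> G)
    (lc : local_coordinates q) (e : R) : 0 < e ->
  \forall y \near (0 : V), forall x, `|Ad lc (q y) x - x| <= e * `|x|.
Proof.
move=> e0; have [A A0 injA] := lc_inj lc; have q0 := lc_zero lc.
have e2 : 0 < e / 2 by rewrite divr_gt0.
have g1 : gdiff q (q \o fst) (0 : V * V) fst.
  exact: (gdiff_comp (sdiff_linear (0 : V * V) (bl_fst V V)) (gdiff_q0 lc)).
have g2 : gdiff q (q \o snd) (0 : V * V) snd.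
  exact: (gdiff_comp (sdiff_linear (0 : V * V) (bl_snd V V)) (gdiff_q0 lc)).
have := gdiff_mul lc (gdiff_mul lc g1 g2) (gdiff_inv lc g1).
have -> : (fun v : V * V => v.1 + Ad lc ((q \o fst) (0 : V * V)) v.2 +
    Ad lc ((q \o fst) (0 : V * V) * (q \o snd) (0 : V * V))%g
    (- Ad lc ((q \o fst) (0 : V * V))^-1%g v.1)) = snd.
  apply/funext => v; rewrite /= q0 mulg1 invg1 !Ad1 addrAC subrr add0r//.
move=> /(gdiff_one _)[|h [h0 sh hq]]; first by rewrite /= q0 !mulg1 mulgV.
have [_ /(_ _ e2)[B B0 hB]] := sh.
have hA := sdiff_near sh h0 A0.
have : \forall p \near (0 : V * V),
    B p /\ A (h p) /\ (q p.1 * q p.2 * (q p.1)^-1)%g = q (h p).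
  by apply: filterI => //; apply: filterI.
move=> [[/= B1 B2] [/= B10 B20] hBB].
apply: filterS B10 => y B1y.
have B2x x : B2 x -> B (y, x) /\ A (h (y, x)) /\ (q y * q x * (q y)^-1)%g = q (h (y, x)).
  by move=> B2x; exact: (hBB (y, x)).
have B20' := nbhs_singleton B20.
have hy0 : h (y, 0) = 0.
  have [_ [Ah E]] := B2x 0 B20'; apply: injA => //; first exact: nbhs_singleton A0.
  by rewrite -E q0 mulg1 mulgV.
have [C [C0 sC hC]] : exists C, [/\ C 0 = 0, sdiff C 0 (Ad lc (q y)) &
    \forall x \near 0, (q y * q x * (q y)^-1)%g = q (C x)].
  by apply: gdiff_one (AdP lc (q y)); rewrite q0 mulg1 mulgV.
have CA := sdiff_near sC C0 A0.
have [_ /(_ _ e2)[D D0 hD]] := sC.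
have bL : bounded_linear (fun x => Ad lc (q y) x - x).
  exact: bl_sub (Ad_bl lc (q y)) (bl_id V).
(* By homogeneity small [x] suffice. One half of [e] pays for conjugation against the identity, the
   other for conjugation against its derivative. *)
apply: (bl_small bL); near=> x.
have [Bx [Ax Ex]] : B (y, x) /\ A (h (y, x)) /\ (q y * q x * (q y)^-1)%g = q (h (y, x)).
  by apply: B2x; near: x.
have hC' : C x = h (y, x).
  apply: injA => //; first by near: x.
  by rewrite -Ex; symmetry; near: x.
have [By _] := B2x 0 B20'.
have := hB _ _ Bx By; rewrite hy0 -hC' subr0.
have -> : (y, x) - (y, 0) = (0, x) :> V * V by congr pair; rewrite /= ?subrr ?subr0.
have -> : `|(0, x) : V * V| = `|x| by rewrite prod_normE/= normr0 max_r.
move=> h1.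
have Dx : D x by near: x.
have := hD _ _ Dx (nbhs_singleton D0); rewrite C0 !subr0 => h2.
have -> : Ad lc (q y) x - x = (C x - x) - (C x - Ad lc (q y) x).
  by rewrite [RHS]addrC opprB subrKA.
by rewrite (le_trans (ler_normB _ _))// [in leRHS](splitr e) mulrDl lerD.
Unshelve. all: by end_near. Qed.

(** * The adjoint action modulo the tangent space of the kernel *)

Section AdjointModKernel.
Context (R : realType) (V : completeNormedModType R) (G Gamma : groupType).
Context (q : V -> G) (lc : local_coordinates q) (fr : finite_frame V).
Context (phi : G -> Gamma) (phiM : {morph phi : x y / (x * y)%g}).
Context (P : V -> V) (Pbl : bounded_linear P).
Context (Pk : forall v, ktangent q phi (P v)).
Context (kP : forall v, ktangent q phi v -> P v = v).
Local Notation gd := (gdiff q).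
Local Notation Ad := (Ad lc).
Local Notation kt := (ktangent q phi).

(** [P] projects onto the tangent vectors of the kernel, so [w - P w] stands for the class of [w]
    modulo them. With [n = b^-1 * a] in the kernel, [Ad b (x - Ad n x) = Ad b x - Ad a x] is such a
    vector. *)
Lemma Ad_eq_mod a b x : phi a = phi b -> Ad a x - P (Ad a x) = Ad b x - P (Ad b x).
Proof.
move=> ab; have pn : phi (b^-1 * a)%g = 1%g by rewrite phiM (morph_inv phiM) ab mulVg.
have := ktangent_Ad lc phiM b (ktangent_commutator lc phiM x pn).
rewrite (blB _ _ (Ad_bl lc b)) -AdM mulVKg => /kP.
rewrite (blB _ _ Pbl) => E.
rewrite -[in X in _ = X - _](subrK (Ad a x) (Ad b x)) -E.
by rewrite addrAC (addrAC (P _)) subrr sub0r addrC.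
Qed.

(* [t |-> Ad (q (t v)) x] modulo the tangent space of the kernel is continuous and
   factors through the countable group [Gamma], hence is constant. *)
Lemma Ad_chart_ktangent : countable [set: Gamma] ->
  exists2 r : R, 0 < r & forall v, `|v| < r -> forall x, kt (Ad (q v) x - x).
Proof.
move=> cG; have /nbhs_normP[r /= r0 hr] := gdiff_near_chart lc.
exists r => // v vr x.
have [I [b [a [ha hb]]]] := fr.
pose f t := Ad (q (t *: v)) x - P (Ad (q (t *: v)) x).
(* Near [t], [q (s *: v)] is [q] of a small vector times [q (t *: v)]; thus [Ad_near1], which
   concerns only elements near [1], gives continuity at every [t]. *)
have cf (t : R^o) : 0 <= t <= 1 -> {for t, continuous (f : R^o -> V)}.
  move=> /andP[t0 t1].
  have [L [k [k0 sk hk]]] : exists L, gd q (t *: v) L.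
    apply: hr => /=; rewrite sub0r normrN normrZ ger0_norm//.
    by rewrite (le_lt_trans _ vr)// ler_piMl.
  have sl : sdiff (fun s : R^o => s *: v) t (fun s => s *: v).
    by apply: sdiff_linear; exact: bl_scale.
  pose z := Ad (q (t *: v)) x.
  have bQ : bounded_linear (fun w : V => w - P w) := bl_sub (bl_id V) Pbl.
  have [C C0 hC] := bQ.2.
  apply/cvgrPdist_le => e e0.
  have e1 : 0 < e / (C + 1) / (`|z| + 1) by rewrite !divr_gt0// ltr_wpDl.
  have := sdiff_near sk k0 (Ad_near1 lc e1) => h1.
  have h2 : \forall w \near t *: v, `|Ad (q w) x - z| <= e / (C + 1).
    apply: filterS2 h1 hk => w h1 ->; rewrite AdM -/z (le_trans (h1 _))//.
    rewrite mulrAC ler_pdivrMr ?ltr_wpDl//; apply: ler_wpM2l; last by rewrite lerDl.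
    by rewrite divr_ge0 ?ltW// ltr_wpDl.
  apply: filterS (sdiff_near sl erefl h2) => s hs.
  rewrite -normrN opprB /f -/z.
  have -> : Ad (q (s *: v)) x - P (Ad (q (s *: v)) x) - (z - P z) =
    (Ad (q (s *: v)) x - z) - P (Ad (q (s *: v)) x - z) by rewrite (blB _ _ bQ).
  rewrite (le_trans (hC _))// (le_trans (ler_wpM2l C0 hs))//.
  rewrite mulrCA; apply: ler_piMr; first exact: ltW.
  by rewrite ler_pdivrMr ?ltr_wpDl// mul1r lerDl.
(* [psi] takes the default value 0 at elements of [Gamma] that the curve does not reach. *)
have [psi hpsi] : exists psi : Gamma -> V, forall t, f t = psi (phi (q (t *: v))).
  have [|psi hpsi] := @choice _ _
    (fun (g : Gamma) y => forall t, phi (q (t *: v)) = g -> f t = y).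
    move=> g; have [[t ht]|nex] := pselect (exists t, phi (q (t *: v)) = g).
      by exists (f t) => s hs; apply: Ad_eq_mod; rewrite hs ht.
    by exists 0 => t ht; case: nex; exists t.
  by exists psi => t; exact: hpsi.
have fi i : a i (f 1) = a i (f 0).
  apply: (@countable_range_const _ (fun t => a i (f t))).
    move=> t t01; apply: (@continuous_comp R^o V R^o f (a i)); first exact: cf.
    exact: sdiff_continuous (sdiff_linear _ (ha i)).
  apply: (@sub_countable _ _ _ [set a i (psi g) | g in [set: Gamma]]).
    by apply: subset_card_le => _ [t _ <-]; exists (phi (q (t *: v))) => //; rewrite hpsi.
  apply: (@sub_countable _ _ _ [set: Gamma]) => //; exact: card_image_le.
have f10 : f 1 = f 0.
  by rewrite (hb (f 1)) (hb (f 0)); apply: eq_bigr => i _; rewrite fi.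
have := f10; rewrite /f scale1r scale0r (lc_zero lc) Ad1 => E.
suff -> : Ad (q v) x - x = P (Ad (q v) x - x) by exact: Pk.
rewrite (blB _ _ Pbl); apply/eqP; rewrite subr_eq.
rewrite -[X in X == _](subrK (P (Ad (q v) x)) (Ad (q v) x)) E.
by rewrite addrAC [eqbRHS]addrAC (addrC x).
Qed.

End AdjointModKernel.

Lemma lip_continuous (R : realType) (V : normedModType R) (w : R^o -> V) (t : R^o)
    (C : R) : (\forall s \near t, `|w s - w t| <= C * `|s - t|) ->
  {for t, continuous w}.
Proof.
move=> h; apply/cvgrPdist_le => e e0.
have C1 : 0 < `|C| + 1 by rewrite ltr_wpDl.
have td : \forall s \near t, `|t - s| <= e / (`|C| + 1).
  apply/nbhs_normP; exists (e / (`|C| + 1)); first by rewrite /= divr_gt0.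
  by move=> s /= /ltW.
apply: filterS2 h td => s hs ts; rewrite distrC (le_trans hs)//.
rewrite distrC (le_trans (ler_wpM2r _ (ler_norm C)))//.
apply: (@le_trans _ _ ((`|C| + 1) * `|t - s|)); first by rewrite ler_wpM2r// lerDl.
by rewrite mulrC -ler_pdivlMr.
Qed.

(** * Integration of curves tangent to the kernel *)

Section KernelCurves.
Context (R : realType) (V : completeNormedModType R) (G Gamma : groupType).
Context (q : V -> G) (lc : local_coordinates q) (fr : finite_frame V).
Context (phi : G -> Gamma) (phiM : {morph phi : x y / (x * y)%g}).
Context (P : V -> V) (Pbl : bounded_linear P).
Context (Pk : forall v, ktangent q phi (P v)).
Context (kP : forall v, ktangent q phi v -> P v = v).
Local Notation gd := (gdiff q).
Local Notation Ad := (Ad lc).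
Local Notation kt := (ktangent q phi).

(** Each [P (e i)] is the velocity of a kernel curve [c i]. The ordered product of the [c i (a i w)]
    has derivative [\sum_i a i w *: P (e i) = P w] at 0, and nearby derivatives stay among the
    kernel tangents because these are stable under sums and [Ad]. *)
Lemma product_curve : exists F : V -> G, [/\ F 0 = 1%g, gd F 0 P &
  \forall w \near 0, (exists2 L, gd F w L & forall v, kt (L v)) /\ phi (F w) = 1%g].
Proof.
have [I [e [a [ha he]]]] := fr.
have [c hc] := @choice _ _ (fun i (c : R^o -> G) => [/\ c 0 = 1%g,
  gd c 0 (fun t => t *: P (e i)) &
  \forall t \near 0, (exists L, gd c t L) /\ phi (c t) = 1%g]) (fun i => Pk (e i)).
pose F r w := foldr (fun i g => c i (a i w) * g)%g 1%g r.
pose LF r w := foldr (fun i v => a i w *: P (e i) + v) 0 r.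
have FP r : [/\ F r 0 = 1%g, gd (F r) 0 (LF r) &
  \forall w \near 0, (exists2 L, gd (F r) w L & forall v, kt (L v)) /\ phi (F r w) = 1%g].
  elim: r => [|i r [Fr0 dF hF]] /=.
    split => //; first exact: gdiff_cst.
    apply: nearW => w; split; last exact: morph_one.
    by exists (fun=> 0); [exact: gdiff_cst|move=> _; exact: ktangent0].
  have [c0 dc hci] := hc i; have ai0 := bl0 (ha i).
  split; first by rewrite /F/= ai0 c0 mul1g.
    have dca : gd (c i \o a i) 0 (fun w => a i w *: P (e i)).
      have s := sdiff_linear 0 (ha i).
      have dc' : gd (c i) (a i 0) (fun t => t *: P (e i)) by rewrite ai0.
      exact: (gdiff_comp s dc').
    have := gdiff_mul lc dca dF; congr (gdiff _ _ _ _).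
    by apply/funext => w; rewrite /= ai0 c0 Ad1.
  have hck := ktangent_curve lc phiM hci.
  have := sdiff_near (sdiff_linear 0 (ha i)) ai0 hck.
  have := sdiff_near (sdiff_linear 0 (ha i)) ai0 hci.
  apply: filterS3 hF => w [[L dL kL] pF] [_ pc] [xi kxi dxi]; split; last first.
    by rewrite phiM pc pF mulg1.
  have dca : gd (c i \o a i) w (fun v => a i v *: xi).
    exact: (gdiff_comp (sdiff_linear w (ha i)) dxi).
  eexists; first exact: (gdiff_mul lc dca dL).
  move=> v; apply: (ktangentD lc phiM); first exact: ktangentZ.
  exact: (ktangent_Ad lc phiM).
have [F0 dF hF] := FP (index_enum I).
exists (F (index_enum I)); split => //; suff -> : P = LF (index_enum I) by [].
apply/funext => w; rewrite [in LHS](he w) /LF.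
elim: (index_enum I) => [|i r IH] /=; first by rewrite big_nil (bl0 Pbl).
by rewrite big_cons (blD _ _ Pbl) (blZ _ _ Pbl) IH.
Qed.

Let bQ : bounded_linear (fun w : V => w - P w) := bl_sub (bl_id V) Pbl.

(** Because [Q] is strictly differentiable and vanishes on the diagonal, comparing [(y, z)] with
    [(z, z)] shows that [Q (y, z)] is [y - z] up to a small multiple of [|y - z|]. *)
Lemma local_division : exists Q : V * V -> V,
  [/\ sdiff Q 0 (fun p => p.1 - p.2),
   \forall p \near (0 : V * V), (q p.1 * (q p.2)^-1)%g = q (Q p) &
   \forall y \near (0 : V), Q (y, y) = 0].
Proof.
have [A A0 injA] := lc_inj lc; have q0 := lc_zero lc.
have g1 : gdiff q (q \o fst) (0 : V * V) fst.
  exact: (gdiff_comp (sdiff_linear (0 : V * V) (bl_fst V V)) (gdiff_q0 lc)).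
have g2 : gdiff q (q \o snd) (0 : V * V) snd.
  exact: (gdiff_comp (sdiff_linear (0 : V * V) (bl_snd V V)) (gdiff_q0 lc)).
have g3 : gd (fun p : V * V => (q p.1 * (q p.2)^-1)%g) 0 (fun p => p.1 - p.2).
  have := gdiff_mul lc g1 (gdiff_inv lc g2); congr (gdiff _ _ _ _).
  by apply/funext => p; rewrite /= q0 invg1 !Ad1.
have [|Q [Q0 sQ hQ]] := gdiff_one _ g3; first by rewrite /= q0 mulgV.
exists Q; split => //.
have sd : sdiff (fun y : V => (y, y)) 0 (fun y => (y, y)).
  exact: sdiff_pair (sdiff_linear _ (bl_id _)) (sdiff_linear _ (bl_id _)).
have hA := sdiff_near sd erefl (sdiff_near sQ Q0 A0).
apply: filterS2 hA (sdiff_near sd erefl hQ) => y Ay E.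
apply: injA => //; first exact: nbhs_singleton A0.
by rewrite -E mulgV.
Qed.

(* In the coordinates [w |-> F w * q (w - P w)], where [F] is a product of curves in
   the kernel, the component [w - P w] is constant along curves tangent to the
   kernel. *)
Lemma kernel_path : exists2 r : R, 0 < r & forall c : R^o -> V, c 0 = 0 ->
  (forall t : R^o, 0 <= t <= 1 ->
    (exists C, \forall s \near t, `|c s| < r /\ `|c s - c t| <= C * `|s - t|) /\
    exists2 xi, kt xi & gd (q \o c) t (fun s => s *: xi)) ->
  phi (q (c 1)) = 1%g.
Proof.
have [A A0 injA] := lc_inj lc; have q0 := lc_zero lc.
have [F [F0 dF hF]] := product_curve.
pose pi := fun w => w - P w.
have Ppi w : P (pi w) = 0 by rewrite /pi (blB _ _ Pbl) (kP (Pk w)) subrr.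
have pipi w : pi (pi w) = pi w by rewrite {1}/pi Ppi subr0.
have pi0 : pi 0 = 0 := bl0 bQ.
have dE : gd (q \o pi) 0 pi.
  have g0 : gd q (pi 0) idfun by rewrite pi0; exact: gdiff_q0.
  exact: (gdiff_comp (sdiff_linear 0 bQ) g0).
(* The derivative is [P w + (w - P w) = w], so [local_right_inverse] yields a Lipschitz [g] that
   expresses points of the chart in the new coordinates. *)
have dPhi : gd (fun w => F w * q (pi w))%g 0 idfun.
  have := gdiff_mul lc dF dE; congr (gdiff _ _ _ _).
  by apply/funext => w; rewrite F0 Ad1 /pi addrC subrK.
have [|h [h0 sh hh]] := gdiff_one _ dPhi.
  by rewrite pi0 q0 F0 mulg1.
have [d d0 [g hg]] := local_right_inverse h0 sh.
have [Q [sQ hQ Qd]] := local_division.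
have [K K0 hK] := bQ.2.
(* This gives [K * eta <= 1 / 2], so that the error in [Q] can be absorbed at the end of the slope
   estimate. *)
pose eta := (2 * (K + 1))^-1.
have K1 : 0 < K + 1 by rewrite ltr_wpDl.
have eta0 : 0 < eta by rewrite invr_gt0 mulr_gt0.
have Q0 : Q 0 = 0 by have := nbhs_singleton Qd.
have [B B0 hB] := sQ.2 _ eta0.
have nE : \forall p \near (0 : V * V),
    [/\ B p, A (Q p) & (q p.1 * (q p.2)^-1)%g = q (Q p)].
  by apply: filterS3 B0 (sdiff_near sQ Q0 A0) hQ => p.
have [[B1 B2] /= [B10 B20] hB12] := nE.
have spi := sdiff_linear (0 : V) bQ.
have nW : \forall w \near (0 : V),
    [/\ (exists2 L, gd F w L & forall v, kt (L v)), phi (F w) = 1%g,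
      (F w * q (pi w))%g = q (h w), B1 (pi w) /\ B2 (pi w) & Q (pi w, pi w) = 0].
  have n1 := sdiff_near spi pi0 B10; have n2 := sdiff_near spi pi0 B20.
  have n3 := sdiff_near spi pi0 Qd.
  near=> w.
  have [hL hp] : (exists2 L, gd F w L & forall v, kt (L v)) /\ phi (F w) = 1%g by near: w.
  split => //; [by near: w| |by near: w].
  by split; near: w.
move: nW => /nbhs_normP[rho /= rho0 hrho].
(* The bound [rho / 2] compensates for [|g x| <= 2 * |x|]. *)
exists (Num.min d (rho / 2)); first by rewrite lt_min d0 divr_gt0.
move=> c c0 hc; pose w s := g (c s); pose E s := pi (w s).
have wP s : `|c s| < Num.min d (rho / 2) -> h (w s) = c s /\
    [/\ (exists2 L, gd F (w s) L & forall v, kt (L v)), phi (F (w s)) = 1%g,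
      (F (w s) * q (E s))%g = q (h (w s)), B1 (E s) /\ B2 (E s) & Q (E s, E s) = 0].
  rewrite lt_min => /andP[sd sr]; have [hw w2 _] := hg _ sd; split => //.
  by apply: hrho => /=; rewrite sub0r normrN /w; lra.
have slope (t : R) : 0 <= t <= 1 -> forall e : R, 0 < e ->
    \forall s \near t, `|E s - E t| <= e * `|s - t|.
  move=> t01 e e0; have [[C hC] [xi kxi dxi]] := hc t t01.
  have [ctr _] := nbhs_singleton hC.
  have [hwt [[L dL kL] _ EFt [Et1 Et2] QEt]] := wP t ctr.
  (* Along [p = (w s, s)], [T p] equals [q (E s) * (q (E t))^-1]. The variables are kept separate
     because [w] is only known to be Lipschitz at [t], while [T] is differentiable in both and its
     derivative takes values in the kernel tangents. *)
  pose T (p : V * R^o) := ((F p.1)^-1 * (q (c p.2) * ((q (c t))^-1 * F (w t))))%g.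
  have T1 : T (w t, t) = 1%g by rewrite /T/= mulVKg mulVg.
  have [LT [dT kLT]] : exists LT, gd T (w t, t) LT /\ forall v, kt (LT v).
    have d1 : gd (F \o fst) (w t, t) (L \o fst).
      exact: (gdiff_comp (sdiff_linear (w t, t) (bl_fst V R^o)) dL).
    have d2 : gd ((q \o c) \o snd) (w t, t) ((fun s => s *: xi) \o snd).
      exact: (gdiff_comp (sdiff_linear (w t, t) (bl_snd V R^o)) dxi).
    eexists; split; first exact: (gdiff_mul lc (gdiff_inv lc d1) (gdiff_mulr lc _ d2)).
    move=> v /=; apply: (ktangentD lc phiM).
      by apply: ktangentN; exact: (ktangent_Ad lc phiM).
    by apply: (ktangent_Ad lc phiM); exact: ktangentZ.
  have [m [m0 sm hm]] := gdiff_one T1 dT.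
  pose C2 := 2 * `|C| + 1; have C20 : 0 < C2 by rewrite ltr_wpDl// mulr_ge0.
  pose e' := e / (2 * (K + 1) * C2).
  have e'0 : 0 < e' by rewrite divr_gt0// !mulr_gt0.
  have [D D0 hD] := sm.2 _ e'0.
  have nZ : \forall p \near (w t, t), [/\ D p, A (m p) & T p = q (m p)].
    by apply: filterS3 D0 (sdiff_near sm m0 A0) hm => p.
  have lipw : \forall s \near t, `|w s - w t| <= 2 * `|C| * `|s - t|.
    apply: filterS hC => s [sr sC].
    move: sr ctr; rewrite !lt_min => /andP[sd _] /andP[td _].
    have [_ _ /(_ _ td) lg] := hg _ sd; rewrite (le_trans lg)// -mulrA ler_pM2l//.
    by rewrite (le_trans sC)// ler_wpM2r// ler_norm.
  have nZs : \forall s \near t,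
      [/\ D (w s, s), A (m (w s, s)) & T (w s, s) = q (m (w s, s))].
    have cws : (w s, s) @[s --> t] --> (w t, t).
      have cw : w @ t --> w t := lip_continuous lipw.
      exact: (cvg_pair cw cvg_id).
    exact: cws nZ.
  apply: filterS3 hC lipw nZs => s [sr sC] ws [Ds As Ts].
  have [hws [_ _ EFs [Es1 Es2] QEs]] := wP s sr.
  (* Both sides are coordinates of the same group element, in the region where [q] is injective. *)
  have QE : Q (E s, E t) = m (w s, s).
    have [_ AQ EQ] := hB12 (E s, E t) (conj Es1 Et2).
    apply: injA => //; rewrite -EQ -Ts /T /= -[in RHS]hws -[in RHS]hwt -EFs -EFt.
    by rewrite invgM mulgA mulKg !mulgA mulgVK.
  have [Bst _ _] := hB12 (E s, E t) (conj Es1 Et2).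
  have [Btt _ _] := hB12 (E t, E t) (conj Et1 Et2).
  have := hB _ _ Bst Btt; rewrite QEt QE /= subrr !subr0.
  have -> : (E s, E t) - (E t, E t) = (E s - E t, 0) :> V * V.
    by congr pair; rewrite /= subrr.
  have -> : `|(E s - E t, 0) : V * V| = `|E s - E t| by rewrite prod_normE/= normr0 max_l.
  move=> h1.
  have := hD _ _ Ds (nbhs_singleton D0); rewrite m0 subr0.
  set X := m (w s, s) in h1 *; set DL := (w s, s) - (w t, t) => h2.
  have DLn : `|DL| <= C2 * `|s - t|.
    rewrite /DL prod_normE/= ge_max; apply/andP; split.
      by rewrite (le_trans ws)// ler_wpM2r// lerDl.
    by rewrite /C2 mulrDl mul1r lerDr mulr_ge0// mulr_ge0.
  (* [pi] kills the kernel tangent [LT DL], so only the error term of [T] survives. *)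
  have piX : pi X = pi (X - LT DL).
    rewrite [RHS](blB _ _ bQ) -[X in _ = _ - X]/(pi (LT DL)).
    by rewrite [pi (LT DL)]/pi (kP (kLT _)) subrr subr0.
  have piEE : E s - E t = pi X - pi (X - (E s - E t)).
    have bpi : bounded_linear pi := bQ.
    rewrite -(blB X (X - (E s - E t)) bpi) subKr (blB (E s) (E t) bpi).
    by rewrite /E !pipi.
  (* The first term is the error of [T], at most [e / 2 * |s - t|]; the second is the error of [Q],
     at most half of the left side, and moves there. *)
  have x1 : `|E s - E t| <= K * (e' * `|DL|) + K * (eta * `|E s - E t|).
    rewrite {1}piEE (le_trans (ler_normB _ _))// lerD//.
      by rewrite piX (le_trans (hK _))// ler_wpM2l.
    by rewrite (le_trans (hK _))// ler_wpM2l.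
  have x2 : K * (eta * `|E s - E t|) <= 1 / 2 * `|E s - E t|.
    rewrite mulrA ler_wpM2r// /eta ler_pdivrMr ?mulr_gt0// mul1r mulrA.
    by rewrite mulVf// mul1r lerDl.
  have x3 : K * (e' * `|DL|) <= e / 2 * `|s - t|.
    apply: (@le_trans _ _ (K * (e' * (C2 * `|s - t|)))).
      by rewrite ler_wpM2l// ler_wpM2l// ltW.
    rewrite !mulrA ler_wpM2r// /e'.
    have -> : K * e / (2 * (K + 1) * C2) * C2 = K / (K + 1) * (e / 2).
      field; rewrite !gt_eqF//.
    rewrite -[leRHS]mul1r ler_wpM2r ?divr_ge0 ?(ltW e0)//.
    by rewrite ler_pdivrMr// mul1r lerDl.
  lra.
have [I [b [a [ha hb]]]] := fr.
have E10 : E 1 = E 0.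
  rewrite (hb (E 1)) (hb (E 0)); apply: eq_bigr => i _; congr (_ *: _).
  apply: (@zero_slope_const _ (fun s => a i (E s))) => t t01 e e0.
  have [Ca Ca0 hCa] := (ha i).2.
  have e1 : 0 < e / (Ca + 1) by rewrite divr_gt0// ltr_wpDl.
  apply: filterS (slope t t01 _ e1) => s hs.
  rewrite -(blB _ _ (ha i)) (le_trans (hCa _))// (le_trans (ler_wpM2l Ca0 hs))//.
  rewrite mulrA ler_wpM2r// mulrCA; apply: ler_piMr; first exact: ltW.
  by rewrite ler_pdivrMr ?ltr_wpDl// mul1r lerDl.
have E0 : E 0 = 0.
  rewrite /E /w c0; have [|_ + _] := hg 0; first by rewrite normr0.
  by rewrite normr0 mulr0 normr_le0 => /eqP ->.
have t1 : 0 <= (1 : R) <= 1 by rewrite ler01 lexx.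
have [[C hC] _] := hc 1 t1; have [c1r _] := nbhs_singleton hC.
have [hw1 [_ pF EF _ _]] := wP 1 c1r.
by rewrite -hw1 -EF E10 E0 q0 mulg1.
Unshelve. all: by end_near. Qed.

End KernelCurves.

(** * Local roots and commutators near the identity *)

Section CommutatorsInKernel.
Context (R : realType) (V : completeNormedModType R) (G Gamma : groupType).
Context (q : V -> G) (lc : local_coordinates q) (fr : finite_frame V).
Local Notation gd := (gdiff q).

(** The power map has derivative [v |-> v *+ m] at 0. Precomposed with division by [m] it has
    derivative the identity, so [local_right_inverse] applies. *)
Lemma local_root (m : nat) (r : R) : (0 < m)%N -> 0 < r ->
  exists2 d : R, 0 < d & forall x, `|x| < d ->
    exists2 z, `|z| < r & q x = (q z ^+ m)%g.
Proof.
move=> m0 r0.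
have gpow k : gd (fun z => q z ^+ k)%g 0 (fun v => v *+ k).
  elim: k => [|k IH]; first exact: gdiff_cst.
  apply: (@gdiff_ext _ _ _ _ _ (fun z => q z * q z ^+ k)%g).
    by apply: nearW => z; rewrite expgS.
  have := gdiff_mul lc (gdiff_q0 lc) IH; congr (gdiff _ _ _ _).
  by apply/funext => v; rewrite (lc_zero lc) Ad1 mulrS.
pose s := fun z : V => m%:R^-1 *: z.
have bs : bounded_linear s.
  split; first by move=> a u v; rewrite /s scalerDr !scalerA mulrC.
  by exists `|m%:R^-1| => // v; rewrite normrZ.
have s0 : s 0 = 0 := bl0 bs.
have g1 : gd (fun z => q (s z) ^+ m)%g 0 idfun.
  have gp : gd (fun z => q z ^+ m)%g (s 0) (fun v => v *+ m) by rewrite s0.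
  have := gdiff_comp (sdiff_linear 0 bs) gp; congr (gdiff _ _ _ _).
  apply/funext => v; rewrite /s /= -scaler_nat scalerA mulfV ?scale1r//.
  by rewrite pnatr_eq0 -lt0n.
have [|h [h0 sh hh]] := gdiff_one _ g1; first by rewrite s0 (lc_zero lc) expg1n.
have [d d0 [g hg]] := local_right_inverse h0 sh.
have /nbhs_normP[rho /= rho0 hrho] := hh.
exists (Num.min d (Num.min rho r / 2)).
  by rewrite !(lt_min, divr_gt0) ?d0 ?rho0 ?r0.
move=> x; rewrite lt_min => /andP[xd xr]; have [hx gx _] := hg _ xd.
have : `|g x| < Num.min rho r by lra.
rewrite lt_min => /andP[g1' g2]; exists (s (g x)).
  rewrite /s normrZ (le_lt_trans _ g2)// ler_piMl// ger0_norm ?invr_ge0//.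
  by rewrite invf_le1 ?ltr0n// ler1n.
by rewrite (hrho (g x)) /= ?hx// sub0r normrN.
Qed.

Context (phi : G -> Gamma) (phiM : {morph phi : x y / (x * y)%g}).
Context (P : V -> V) (Pbl : bounded_linear P).
Context (Pk : forall v, ktangent q phi (P v)).
Context (kP : forall v, ktangent q phi v -> P v = v).
Local Notation Ad := (Ad lc).
Local Notation kt := (ktangent q phi).

(** For fixed [v], [kernel_path] is applied to the coordinates of the commutator of [q (t *: x)] and
    [q v], a curve that starts at [1]. *)
Lemma commutator_kernel : countable [set: Gamma] ->
  exists2 r : R, 0 < r & forall x v, `|x| < r -> `|v| < r ->
    phi (q x * (q v * (q x)^-1 * (q v)^-1))%g = 1%g.
Proof.
move=> cG; have [A A0 injA] := lc_inj lc; have q0 := lc_zero lc.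
have [r1 r10 h1] := Ad_chart_ktangent lc fr phiM Pbl Pk kP cG.
have /nbhs_normP[r2 /= r20 h2] := gdiff_near_chart lc.
have [r0 r00 h0] := kernel_path lc fr phiM Pbl Pk kP.
pose com (p : V * V) := (q p.1 * (q p.2 * (q p.1)^-1 * (q p.2)^-1))%g.
have g1 : gdiff q (q \o fst) (0 : V * V) fst.
  exact: (gdiff_comp (sdiff_linear (0 : V * V) (bl_fst V V)) (gdiff_q0 lc)).
have g2 : gdiff q (q \o snd) (0 : V * V) snd.
  exact: (gdiff_comp (sdiff_linear (0 : V * V) (bl_snd V V)) (gdiff_q0 lc)).
have g3 := gdiff_mul lc g1
  (gdiff_mul lc (gdiff_mul lc g2 (gdiff_inv lc g1)) (gdiff_inv lc g2)).
have [|K [K0 sK hK]] := gdiff_one _ g3; first by rewrite /= q0 invg1 !mulg1.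
have [C C0 [B B0 hB]] := sdiff_lip sK.
have : \forall p \near (0 : V * V), [/\ B p, A (K p), com p = q (K p) & `|K p| < r0].
  have nK : \forall p \near (0 : V * V), `|K p| < r0.
    apply: (sdiff_near sK K0 (P := fun z => `|z| < r0)); apply/nbhs_normP.
    by exists r0 => // z /=; rewrite sub0r normrN.
  have nA := sdiff_near sK K0 A0; near=> p; split; by near: p.
move=> /nbhs_normP[r3 /= r30 h3].
(* Halving keeps [s *: x] in the good region for all [|s| < 2], hence on neighbourhoods of both ends
   of [[0, 1]]. *)
pose r := Num.min r1 (Num.min r2 r3) / 2.
have rE x : `|x| < r -> [/\ `|x| < r1, `|x| < r2 / 2 & `|x| < r3 / 2].
  rewrite /r => xr; have : 2 * `|x| < Num.min r1 (Num.min r2 r3) by lra.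
  by rewrite !lt_min => /and3P[? ? ?]; split; have := normr_ge0 x; lra.
exists r; first by rewrite divr_gt0// !lt_min r10 r20.
move=> x v /rE[x1 x2 x3] /rE[v1 v2 v3].
pose l := fun s : R^o => s *: x; pose c := fun s : R^o => K (l s, v).
have bl : bounded_linear l := bl_scale x.
have l2 (s : R^o) : `|s| < 2 ->
    [/\ B (l s, v), A (c s), com (l s, v) = q (c s) & `|c s| < r0].
  move=> s2; apply: h3 => /=; rewrite sub0r normrN prod_normE /= gt_max.
  apply/andP; split; last by have := normr_ge0 v; lra.
  rewrite normrZ; have := normr_ge0 x; have := normr_ge0 s => ? ?.
  have : `|s| * `|x| <= 2 * `|x| by rewrite ler_wpM2r// ltW.
  by lra.
have near2 (t : R^o) : 0 <= t <= 1 -> \forall s \near t, `|s| < 2.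
  move=> /andP[t0 t1]; apply/nbhs_normP; exists 1 => //= s /= ts.
  have : `|s| <= `|t - s| + `|t| by rewrite -{1}(subKr t s) [leRHS]addrC ler_normB.
  rewrite (ger0_norm t0); lra.
have K1 : q (c 1) = com (x, v).
  have [|_ _ <- _] := l2 1; first by rewrite normr1 ltr1n.
  by rewrite /l scale1r.
rewrite -[X in phi X]/(com (x, v)) -K1; apply: h0.
  have [|_ Ac E _] := l2 0; first by rewrite normr0.
  apply: injA => //; first exact: nbhs_singleton A0.
  by rewrite -E /com /l /= scale0r q0 invg1 mulg1 mul1g mulgV.
move=> t t01; have n2 := near2 t t01; split.
  exists (C * `|x|); apply: filterS n2 => s s2.
  have [Bs _ _ ->] := l2 s s2; split => //.
  have [Bt _ _ _] := l2 t (nbhs_singleton (near2 t t01)).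
  rewrite (le_trans (hB _ _ Bs Bt))// -mulrA ler_wpM2l ?(ltW C0)//.
  have -> : (l s, v) - (l t, v) = ((s - t) *: x, 0) :> V * V.
    by congr pair; rewrite /= ?subrr// /l scalerBl.
  by rewrite prod_normE/= normr0 max_l// normrZ mulrC.
have [L dL] : exists L, gd q (l t) L.
  apply: h2 => /=; rewrite sub0r normrN normrZ.
  move: t01 => /andP[t0 t1]; rewrite ger0_norm//.
  have : t * `|x| <= `|x| by rewrite ler_piMl.
  by have := normr_ge0 x; lra.
have dql : gd (q \o l) t (L \o l) := gdiff_comp (sdiff_linear t bl) dL.
set a := q (l t); set y := q v.
have dc := gdiff_mul lc dql (gdiff_mulr lc (y^-1)%g (gdiff_mull lc y (gdiff_inv lc dql))).
have dqc : gd (q \o c) t (fun s => L (l s) + Ad a (Ad y (- Ad a^-1%g (L (l s))))).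
  apply: gdiff_ext dc; apply: filterS n2 => s s2.
  by have [_ _ E _] := l2 s s2; exact: E.
exists (L (l 1) + Ad a (Ad y (- Ad a^-1%g (L (l 1))))); last first.
  by rewrite -[X in gd _ _ X](bl_line (gdiff_bl dqc)).
set z := L (l 1).
(* With [u = Ad a^-1 z], the velocity is [- Ad a (Ad y u - u)], and [Ad y u - u] is a kernel tangent
   because [v] is small. *)
have := ktangentN (ktangent_Ad lc phiM a (h1 v v1 (Ad a^-1%g z))).
rewrite (blB _ _ (Ad_bl lc a)) -(AdM lc a a^-1%g) mulgV Ad1 opprB.
by rewrite !(blN _ (Ad_bl lc _)).
Unshelve. all: by end_near. Qed.

End CommutatorsInKernel.

(** Among matrices whose row space lies in [S], one of maximal rank has row space exactly [S]:
    adjoining a vector of [S] cannot raise the rank. [P] is the projection onto it along a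
    complement. *)
Lemma subspace_projector (R : realType) n (S : set 'rV[R]_n) :
  S 0 -> (forall x y, S x -> S y -> S (x + y)) ->
  (forall a x, S x -> S (a *: x)) ->
  exists P : 'M[R]_n, (forall v, S (v *m P)) /\ (forall v, S v -> v *m P = v).
Proof.
move=> S0 SD SZ.
pose rk k := `[< exists2 A : 'M[R]_n, (forall v, S (v *m A)) & \rank A = k >].
have ex : exists k, rk k.
  by exists 0%N; apply/asboolP; exists 0; [move=> v; rewrite mulmx0|rewrite mxrank0].
have ub k : rk k -> (k <= n)%N by move=> /asboolP[A _ <-]; exact: rank_leq_row.
case: (ex_maxnP ex ub) => k /asboolP[A SA rA] max.
have SsubA v : S v -> (v <= A)%MS.
  move=> Sv; have SB w : S (w *m (A + v)%MS).
    have /sub_addsmxP[[u1 u2] ->] : (w *m (A + v)%MS <= A + v)%MS by exact: submxMl.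
    apply: SD; first exact: SA.
    by rewrite [u2]mx11_scalar mul_scalar_mx; exact: SZ.
  have /max : rk (\rank (A + v)%MS) by apply/asboolP; exists (A + v)%MS.
  rewrite -rA => le.
  have : (A + v <= A)%MS by rewrite -(geq_leqif (mxrank_leqif_sup (addsmxSl A v))).
  by rewrite addsmx_sub => /andP[].
exists (proj_mx A A^C%MS); split => [v|v Sv].
  have /submxP[D ->] : (v *m proj_mx A A^C%MS <= A)%MS by exact: proj_mx_sub.
  exact: SA.
by apply: proj_mx_id; [exact: capmx_compl|exact: SsubA].
Qed.

(** * Finitely generated groups *)

Section Subgroups.
Context (G : groupType).
Implicit Types (A B S T H : set G).
Local Notation gen S := (smallest (@is_subgroup G) S).

Lemma subgroup1 H : is_subgroup H -> H 1%g.
Proof. by case. Qed.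

Lemma subgroupV H x : is_subgroup H -> H x -> H (x^-1)%g.
Proof. by move=> [H1 HV] Hx; rewrite -div1g; exact: HV. Qed.

Lemma subgroupM H x y : is_subgroup H -> H x -> H y -> H (x * y)%g.
Proof. by move=> sH Hx Hy; rewrite -(invgK y); apply: sH.2 => //; exact: subgroupV. Qed.

Lemma subgroupX H x n : is_subgroup H -> H x -> H (x ^+ n)%g.
Proof.
move=> sH Hx; elim: n => [|n IH]; first by rewrite expg0; exact: subgroup1.
by rewrite expgS; exact: subgroupM.
Qed.

Lemma generated_subgroup S : is_subgroup (gen S).
Proof.
split; first by move=> H [[H1 _] _].
by move=> x y hx hy H [sH SH]; apply: sH.2; [apply: hx|apply: hy].
Qed.

(** The group is a union of finite stages [B n], each formed from the quotients of the previous one.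
    The stages increase since they contain [1]. *)
Lemma finitely_generated_countable : finitely_generated G -> countable [set: G].
Proof.
move=> [S fS SG].
pose B := fix B n := if n is k.+1 then [set (x * y^-1)%g | x in B k & y in B k]
                     else S `|` [set 1%g].
have fB n : finite_set (B n).
  elim: n => [|n IH]; first by rewrite /= finite_setU; split.
  exact: finite_image2.
have B1 n : B n 1%g.
  elim: n => [|n IH]; first by right.
  by exists 1%g => //; exists 1%g => //; rewrite invg1 mulg1.
have Bm n m x : (n <= m)%N -> B n x -> B m x.
  move=> /subnK <-; elim: (m - n)%N => // k IH /IH Bx.
  by rewrite addSn; exists x => //; exists 1%g => //; rewrite invg1 mulg1.
have : [set: G] `<=` \bigcup_n B n.
  rewrite -SG; apply: smallest_sub; last by move=> x Sx; exists 0%N => //; left.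
  split; first by exists 0%N.
  move=> x y [n _ Bx] [m _ By]; exists (maxn n m).+1 => //.
  exists x; first exact: (Bm _ _ _ (leq_maxl n m) Bx).
  by exists y => //; exact: (Bm _ _ _ (leq_maxr n m) By).
move=> /subset_card_le/sub_countable; apply.
by apply: bigcup_countable => // n _; exact: finite_set_countable.
Qed.

(* Schreier: the elements [t s t'^-1] of [A], with [s] a generator or its inverse
   and [t], [t'] coset representatives, generate [A]. *)
Lemma finite_index_generated A T : finitely_generated G -> is_subgroup A ->
  finite_set T -> (forall g, exists2 t, T t & A (g * t^-1)%g) ->
  exists2 S, finite_set S & gen S = A.
Proof.
move=> [S fS SG] sA fT hT.
pose T1 := T `|` [set 1%g]; pose S1 := S `|` [set x^-1 | x in S]%g.
have fT1 : finite_set T1 by rewrite finite_setU.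
have fS1 : finite_set S1 by rewrite finite_setU; split => //; exact: finite_image.
pose U := [set (x * y^-1)%g | x in [set (t * s)%g | t in T1 & s in S1] & y in T1].
have fU : finite_set U by apply: finite_image2 => //; exact: finite_image2.
(* Representatives lying in [A] are included as generators: an element of [A] ends up as [b * t]
   with [t] such a representative. [1] is in [T1] so that the rewriting can start from it. *)
exists ((U `|` T1) `&` A); first by apply: finite_setIl; rewrite finite_setU.
set B := gen _.
have sB : is_subgroup B := generated_subgroup _.
have subB x : (U `|` T1) x -> A x -> B x by move=> Ux Ax H [_]; apply; split.
apply/seteqP; split; first by apply: smallest_sub => // x [].
(* [W] consists of the [g] whose right multiplication preserves the union of the cosets [B t]. It is
   visibly closed under products only, hence the symmetric set used below. *)
pose W := [set g | forall t, T1 t ->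
  exists2 b, B b & exists2 t', T1 t' & (t * g = b * t')%g].
have WM g h : W g -> W h -> W (g * h)%g.
  move=> Wg Wh t /Wg[b Bb [t' /Wh[b' Bb' [t'' Tt'' E'] E]]].
  exists (b * b')%g; first exact: (subgroupM sB).
  by exists t'' => //; rewrite mulgA E -mulgA E' mulgA.
have WS1 s : S1 s -> W s.
  move=> Ss t Tt; have [t' Tt' At'] := hT (t * s)%g.
  exists (t * s * t'^-1)%g; last by exists t'; [left|rewrite mulgVK].
  apply: subB => //; left; exists (t * s)%g; first by exists t => //; exists s.
  by exists t' => //; left.
have W1 : W 1%g.
  move=> t Tt; exists 1%g; first exact: subgroup1.
  by exists t => //; rewrite mulg1 mul1g.
have : [set: G] `<=` [set g | W g /\ W (g^-1)%g].
  rewrite -SG; apply: smallest_sub => [|s Ss]; last first.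
    by split; apply: WS1; [left|right; exists s].
  split; first by rewrite /= invg1.
  move=> x y [Wx Wx'] [Wy Wy'] /=; split; first exact: WM.
  by rewrite invgM invgK; exact: WM.
move=> WT a Aa; have [Wa _] := WT a I.
have [b Bb [t Tt E]] : exists2 b, B b & exists2 t', T1 t' & (1 * a = b * t')%g.
  by apply: Wa; right.
have Bsub : B `<=` A by apply: smallest_sub => // x [].
rewrite mul1g in E; rewrite E; apply: (subgroupM sB) => //; apply: subB; first by right.
by rewrite -(mulKg b t) -E; apply: subgroupM => //; apply: subgroupV => //; exact: Bsub.
Qed.

(* Working modulo a subgroup [B], which absorbs the generators one by one: once [A]
   is generated by [a] modulo [B], divisibility by 2 puts an odd power [a ^+ d] in
   [B], and then divisibility by [d] puts [A] in [B]. *)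
Lemma divisible_abelian_generated A B (s : seq G) :
  is_subgroup A -> (forall x y, A x -> A y -> (x * y = y * x)%g) ->
  is_subgroup B -> B `<=` A -> (forall x, x \in s -> A x) ->
  A `<=` gen (B `|` [set` s]) ->
  (forall m x, (0 < m)%N -> A x ->
    exists2 y, A y & exists2 b, B b & (x = y ^+ m * b)%g) ->
  A `<=` B.
Proof.
move=> sA cA; elim: s B => [|a s IH] B sB BA sAs Agen div.
  by apply: subset_trans Agen _; apply: smallest_sub => // x [].
have Aa : A a by apply: sAs; rewrite mem_head.
have AX x n : A x -> A (x ^+ n)%g by exact: subgroupX.
(* The subgroup generated by [B] and [a]; exponents on both sides avoid integer powers. *)
pose B' := [set x | A x /\ exists i j, exists2 b, B b & (x * a ^+ i = a ^+ j * b)%g].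
have AB' : A `<=` B'.
  apply: IH => //.
  - split; first split; first exact: subgroup1.
      by exists 0%N, 0%N, 1%g; [exact: subgroup1|rewrite expg0 !mulg1].
    move=> x y [Ax [i [j [b Bb xE]]]] [Ay [k [l [c Bc yE]]]].
    split; first exact: sA.2.
    exists (l + i)%N, (j + k)%N, (b * c^-1)%g; first exact: sB.2.
    have yV : (y^-1 * a ^+ l = a ^+ k * c^-1)%g.
      by rewrite -[(a ^+ l)%g](mulgK c) -yE !mulgA mulVg mul1g.
    rewrite expgnDr mulgA -(mulgA x) yV -mulgA.
    rewrite (cA (a ^+ k * c^-1)%g) ?mulgA; last 2 first.
    + by apply: subgroupM => //; [exact: AX|apply: subgroupV => //; exact: BA].
    + exact: AX.
    rewrite xE expgnDr -!mulgA; congr (_ * _)%g; rewrite !mulgA; congr (_ * _)%g.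
    by apply: cA; [exact: BA|exact: AX].
  - by move=> x [].
  - by move=> x xs; apply: sAs; rewrite inE xs orbT.
  - apply: subset_trans Agen _; apply: smallest_sub; first exact: generated_subgroup.
    have aB' x : x = a -> B' x.
      move=> ->; split => //; exists 0%N, 1%N, 1%g; first exact: subgroup1.
      by rewrite expg0 expg1.
    have BB' : B `<=` B'.
      move=> x Bx; split; first exact: BA.
      by exists 0%N, 0%N, x => //; rewrite expg0 mulg1 mul1g.
    move=> x [/BB' B'x|/=]; first by move=> H [_]; apply; left.
    rewrite inE => /predU1P[/aB' B'x|xs]; first by move=> H [_]; apply; left.
    by move=> H [_]; apply; right.
  - move=> m x m0 /(div m x m0)[y Ay [b Bb E]]; exists y => //; exists b => //.
    split; first exact: BA.
    by exists 0%N, 0%N, b => //; rewrite expg0 mulg1 mul1g.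
have powE d y i j b : A y -> B b -> (y * a ^+ i = a ^+ j * b)%g ->
    (y ^+ d * a ^+ (i * d) = a ^+ (j * d) * b ^+ d)%g.
  move=> Ay Bb E; rewrite !expgnA -!expgMn ?E//; apply: cA => //; try exact: AX.
  exact: BA.
have [d d0 Bd] : exists2 d, (0 < d)%N & B (a ^+ d)%g.
  have [y Ay [b0 Bb0 E]] := div 2%N a isT Aa.
  have [_ [i [j [b Bb yE]]]] := AB' y Ay.
  have := powE 2%N y i j b Ay Bb yE => y2E.
  have aE : (a ^+ (i * 2).+1 = a ^+ (j * 2) * (b ^+ 2 * b0))%g.
    have cb : (b0 * a ^+ (i * 2) = a ^+ (i * 2) * b0)%g.
      by apply: cA; [exact: BA|exact: AX].
    rewrite expgS; transitivity (y ^+ 2 * b0 * a ^+ (i * 2))%g; first by rewrite -E.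
    rewrite -(mulgA (y ^+ 2)%g) cb (mulgA (y ^+ 2)%g) y2E.
    exact/esym/mulgA.
  have Bc : B (b ^+ 2 * b0)%g by apply: subgroupM => //; exact: subgroupX.
  (* The two exponents of [a] have different parity, so their difference [d] is positive in either
     case. *)
  have [le|lt] := leqP (i * 2).+1 (j * 2).
    exists (j * 2 - (i * 2).+1)%N.
      rewrite subn_gt0 ltn_neqAle le andbT; apply/eqP => /(congr1 odd).
      by rewrite /= !oddM !andbF.
    have -> : (a ^+ (j * 2 - (i * 2).+1) = (b ^+ 2 * b0)^-1)%g.
      apply: (@mulgI _ (a ^+ (i * 2).+1)%g); rewrite -expgnDr subnKC// aE.
      by rewrite mulgK.
    exact: subgroupV.
  exists ((i * 2).+1 - j * 2)%N; first by rewrite subn_gt0.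
  have -> : (a ^+ ((i * 2).+1 - j * 2) = b ^+ 2 * b0)%g.
    by apply: (@mulgI _ (a ^+ (j * 2))%g); rewrite -expgnDr subnKC// ltnW.
  by [].
move=> x Ax; have [y Ay [b2 Bb2 ->]] := div d x d0 Ax.
have [_ [i [j [b Bb yE]]]] := AB' y Ay.
apply: subgroupM => //.
have := powE d y i j b Ay Bb yE; rewrite (mulnC i) (mulnC j) !expgnA => E.
rewrite -(mulgK ((a ^+ d) ^+ i) (y ^+ d))%g E.
by apply: sB.2; [apply: subgroupM => //|]; exact: subgroupX.
Qed.

End Subgroups.

(** * Lie groups *)

Section LieCharts.
Context (R : realType) (n : nat) (G : lieGroupType R n).
Local Notation V := 'rV[R]_n.
Implicit Types c d k : chart V G.

Lemma lie_mul_continuous : continuous (fun x : G * G => (x.1 * x.2)%g).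
Proof. exact: (@lie_mul_smooth R n G).1. Qed.

Lemma lie_inv_continuous : continuous (fun x : G => (x^-1)%g).
Proof. exact: (@lie_inv_smooth R n G).1. Qed.

Lemma continuous_mulg (T : topologicalType) (f g : T -> G) (w : T) :
  {for w, continuous f} -> {for w, continuous g} ->
  {for w, continuous (fun u => (f u * g u)%g)}.
Proof.
move=> cf cg.
have cfg : {for w, continuous (fun u => (f u, g u))} by apply: cvg_pair.
exact: (continuous_comp cfg (@lie_mul_continuous (f w, g w))).
Qed.

Lemma continuous_invg (T : topologicalType) (f : T -> G) (w : T) :
  {for w, continuous f} -> {for w, continuous (fun u => (f u)^-1%g)}.
Proof. by move=> cf; exact: (continuous_comp cf (@lie_inv_continuous (f w))). Qed.

Lemma near_chart_dom (T : topologicalType) (f : T -> G) (w : T) k :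
  {for w, continuous f} -> chart_dom k (f w) -> \forall u \near w, chart_dom k (f u).
Proof.
move=> cf kf; apply: cf; apply: open_nbhs_nbhs; split => //.
exact: chart_dom_open.
Qed.

(** Three independent charts are allowed because conjugation by [a] also passes through charts at
    [a] and [a^-1]. Only the C^1 part of smoothness is used. *)
Lemma sdiff_mul_charts c d k u v : lie_atlas c -> lie_atlas d -> lie_atlas k ->
  chart_img c u -> chart_img d v -> chart_dom k (chart_inv c u * chart_inv d v)%g ->
  exists L, sdiff (fun p : V * V =>
    chart_fun k (chart_inv c p.1 * chart_inv d p.2)%g) (u, v) L.
Proof.
move=> Ac Ad Ak cu dv kuv.
have pcd : prod_atlas lie_atlas lie_atlas (prod_chart c d) by exists c => //; exists d.
have [_ /(_ (prod_chart c d) k pcd Ak 1%N)] := @lie_mul_smooth R n G.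
set U := _ `&` _; set f := _ \o _ => fC1.
exists ('d f (u, v)); apply: (@sdiff_of_C1 _ _ _ U f) => //.
  exact: finite_frame_prod (finite_frame_rV _ _) (finite_frame_rV _ _).
rewrite openE => p [pcd' pk]; rewrite /interior; apply: filterI.
  by apply: open_nbhs_nbhs; split => //; exact: chart_img_open.
have cp : {for p, continuous (chart_inv (prod_chart c d))} by exact: chart_inv_continuous.
have cm := continuous_comp cp (@lie_mul_continuous (chart_inv (prod_chart c d) p)).
exact: near_chart_dom cm pk.
Qed.

Lemma sdiff_inv_charts c k u : lie_atlas c -> lie_atlas k ->
  chart_img c u -> chart_dom k (chart_inv c u)^-1%g ->
  exists L, sdiff (fun x : V => chart_fun k (chart_inv c x)^-1%g) u L.
Proof.
move=> Ac Ak cu ku.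
have [_ /(_ c k Ac Ak 1%N)] := @lie_inv_smooth R n G.
set U := _ `&` _; set f := _ \o _ => fC1.
exists ('d f u); apply: (@sdiff_of_C1 _ _ _ U f) => //.
  exact: finite_frame_rV.
rewrite openE => p [pc pk]; rewrite /interior; apply: filterI.
  by apply: open_nbhs_nbhs; split => //; exact: chart_img_open.
have cp : {for p, continuous (chart_inv c)} by exact: chart_inv_continuous.
exact: near_chart_dom (continuous_invg cp) pk.
Qed.

Lemma exists_chart (x : G) : exists2 c : chart V G, lie_atlas c & chart_dom c x.
Proof. by have [h _] := @lie_atlasP R n G; exact: h. Qed.

Section AtOne.
Context (c : chart V G) (Ac : lie_atlas c) (c1 : chart_dom c 1%g).

Definition center_inv (v : V) : G := chart_inv c (v + chart_fun c 1%g).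
Definition center_fun (x : G) : V := chart_fun c x - chart_fun c 1%g.
Local Notation q := center_inv.
Local Notation e := (chart_fun c 1%g).

Lemma center_inv0 : q 0 = 1%g.
Proof. by rewrite /q add0r chart_funK. Qed.

Lemma center_funK x : chart_dom c x -> q (center_fun x) = x.
Proof. by move=> cx; rewrite /q /center_fun subrK chart_funK. Qed.

Let shift0 v : sdiff (fun u : V => u + e) v idfun := sdiff_shift e v.

Lemma center_img : \forall v \near (0 : V), chart_img c (v + e).
Proof.
apply: (sdiff_near (shift0 0) (add0r _)); apply: open_nbhs_nbhs; split.
  exact: chart_img_open.
exact: chart_fun_img.
Qed.

Lemma center_inv_continuous v : chart_img c (v + e) -> {for v, continuous q}.
Proof.
move=> cv; exact: (cvg_comp _ _ (sdiff_continuous (shift0 v)) (chart_inv_continuous cv)).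
Qed.

Lemma center_read (W : normedModType R) (f : W -> G) (w : W) L :
  {for w, continuous f} -> f w = 1%g -> sdiff (chart_fun c \o f) w L ->
  exists C L, [/\ C w = 0, sdiff (C : W -> V) w L & \forall u \near w, f u = q (C u)].
Proof.
move=> cf fw sf; exists (center_fun \o f), L; split.
- by rewrite /center_fun /= fw subrr.
- have := sdiff_comp sf (sdiff_shift (- e) _); exact.
have : chart_dom c (f w) by rewrite fw.
move=> /(near_chart_dom cf); apply: filterS => u cu.
by rewrite /= center_funK.
Qed.

Lemma lie_local_coordinates : local_coordinates q.
Proof.
have e1 : chart_img c e by exact: chart_fun_img.
have inve : chart_inv c e = 1%g by rewrite chart_funK.
have cq0 : {for 0, continuous q} by apply: center_inv_continuous; rewrite add0r.
split.
- exact: center_inv0.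
- exists [set v | chart_img c (v + e)]; first exact: center_img.
  move=> u v /= cu cv /(congr1 (chart_fun c)); rewrite /q !chart_invK//.
  exact: addIr.
- have [|L sL] := @sdiff_mul_charts c c c e e Ac Ac Ac e1 e1.
    by rewrite inve mulg1.
  have sh : sdiff (fun p : V * V => (p.1 + e, p.2 + e)) 0 idfun.
    have s1 := sdiff_comp (sdiff_linear (0 : V * V) (bl_fst V V)) (sdiff_shift e _).
    have s2 := sdiff_comp (sdiff_linear (0 : V * V) (bl_snd V V)) (sdiff_shift e _).
    by have := sdiff_pair s1 s2; congr (sdiff _ _ _); apply/funext => -[].
  apply: (@center_read (V * V)%type (fun p => q p.1 * q p.2)%g 0 L).
  + apply: continuous_mulg.
      exact: (@continuous_comp (V * V)%type V G fst q 0 cvg_fst cq0).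
    exact: (@continuous_comp (V * V)%type V G snd q 0 cvg_snd cq0).
  + by rewrite /= center_inv0 mulg1.
  + have sL' : sdiff (fun p : V * V => chart_fun c (chart_inv c p.1 * chart_inv c p.2)%g)
        ((0 : V * V).1 + e, (0 : V * V).2 + e) L by rewrite /= add0r.
    exact: (sdiff_comp sh sL').
- have [|L sL] := @sdiff_inv_charts c c e Ac Ac e1; first by rewrite inve invg1.
  apply: (@center_read V (fun p => (q p)^-1)%g 0 L).
  + exact: continuous_invg.
  + by rewrite center_inv0 invg1.
  + have sL' : sdiff (fun p : V => chart_fun c (chart_inv c p)^-1%g) (0 + e) L.
      by rewrite add0r.
    exact: (sdiff_comp (shift0 0) sL').
(* Conjugation is read as two multiplications: [a * q x] in a chart [d] at [a], then by [a^-1], seen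
   in a chart [k], back into [c]. *)
- move=> a.
  have [d Ad da] := exists_chart a; have [k Ak ka] := exists_chart a^-1%g.
  have dfa := chart_fun_img da; have kfa := chart_fun_img ka.
  have [|L sL] := @sdiff_mul_charts d c d _ e Ad Ac Ad dfa e1.
    by rewrite inve mulg1 chart_funK.
  have [|K sK] := @sdiff_mul_charts d k c _ _ Ad Ak Ac dfa kfa.
    by rewrite !chart_funK// mulgV.
  have s1 : sdiff (fun x : V => (chart_fun d a, x + e)) 0 (fun x => (0, x)).
    exact: sdiff_pair (sdiff_cst _ _) (shift0 0).
  have s1' : sdiff (fun x : V => chart_fun d (a * q x)%g) 0 (L \o (fun x => (0, x))).
    have sL' : sdiff (fun p : V * V => chart_fun d (chart_inv d p.1 * chart_inv c p.2)%g)
      (chart_fun d a, 0 + e) L by rewrite add0r.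
    have := sdiff_comp s1 sL'; apply: sdiff_ext.
    by apply: (@nearW _ (nbhs (0 : V))) => x /=; rewrite chart_funK.
  have s2 : sdiff (fun x : V => (chart_fun d (a * q x)%g, chart_fun k a^-1%g)) 0
      (fun x => (L (0, x), 0)).
    exact: sdiff_pair s1' (sdiff_cst _ _).
  have caq : {for 0, continuous (fun x : V => a * q x)%g}.
    by apply: (@continuous_mulg _ (fun=> a)) => //; exact: cst_continuous.
  apply: (@center_read V (fun x => a * q x * a^-1)%g 0 (K \o (fun x => (L (0, x), 0)))).
  + by apply: continuous_mulg => //; exact: cst_continuous.
  + by rewrite center_inv0 mulg1 mulgV.
  + have sK' : sdiff (fun p : V * V => chart_fun c (chart_inv d p.1 * chart_inv k p.2)%g)
      (chart_fun d (a * q 0)%g, chart_fun k a^-1%g) K by rewrite center_inv0 mulg1.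
    have := sdiff_comp s2 sK'; apply: sdiff_ext.
    have : chart_dom d (a * q 0)%g by rewrite center_inv0 mulg1.
    move=> /(near_chart_dom caq).
    by apply: (@filterS _ (nbhs (0 : V))) => x dx /=; rewrite !chart_funK.
(* For [lc_near], [h] is the coordinate of [q x * (q v)^-1], which is [1] at [x = v]. *)
apply: (@filterS _ (nbhs (0 : V)) _ _ _ _ center_img) => v cv.
have [k Ak ka] := exists_chart (q v)^-1%g; have kfa := chart_fun_img ka.
have [|L sL] := @sdiff_mul_charts c k c _ _ Ac Ak Ac cv kfa.
  by rewrite chart_funK// mulgV.
have s1 : sdiff (fun x : V => (x + e, chart_fun k (q v)^-1%g)) v (fun x => (x, 0)).
  exact: sdiff_pair (shift0 v) (sdiff_cst _ _).
have [|||h [K [h0 sh hh]]] :=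
    @center_read V (fun x => q x * (q v)^-1)%g v (L \o (fun x => (x, 0))).
- by apply: continuous_mulg; [exact: center_inv_continuous|exact: cst_continuous].
- by rewrite mulgV.
- have := sdiff_comp s1 sL; apply: sdiff_ext.
  by apply: (@nearW _ (nbhs (v : V))) => x /=; rewrite (chart_funK ka).
exists h, K; split => //; apply: (@filterS _ (nbhs (v : V)) _ _ _ _ hh) => u <-.
by rewrite mulgVK.
Qed.

End AtOne.
End LieCharts.

Lemma bl_mulmx (R : realType) m n (P : 'M[R]_(m, n)) :
  bounded_linear (fun v : 'rV[R]_m => v *m P).
Proof.
split; first by move=> a u v; rewrite mulmxDl scalemxAl.
exists (\sum_i \sum_j `|P i j|).
  by apply: sumr_ge0 => i _; apply: sumr_ge0.
move=> v; apply: rV_norm_le => [|j].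
  by apply: mulr_ge0 => //; apply: sumr_ge0 => i _; apply: sumr_ge0.
rewrite mxE (le_trans (ler_norm_sum _ _ _))// mulr_suml ler_sum// => i _.
rewrite normrM mulrC ler_pM// ?rV_norm_ge//.
by rewrite (bigD1 j)//= lerDl sumr_ge0.
Qed.

(** * Topology of the identity component *)

Section LieTopology.
Context (R : realType) (n : nat) (G : lieGroupType R n).
Local Notation G0 := (identity_component G).
Local Notation gen S := (smallest (@is_subgroup G) S).

Lemma identity_component_subgroup : is_subgroup G0.
Proof.
split; first exact: connected_component_refl.
move=> x y Gx Gy; pose f := fun z : G => (z * y^-1)%g.
have cf : continuous f.
  move=> z; apply: (@continuous_mulg _ _ _ _ id (fun=> y^-1%g)).
    exact: cvg_id.
  exact: cst_continuous.
have : f @` G0 `<=` G0.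
  apply: connected_component_max => //; first by exists y => //; rewrite /f mulgV.
  apply: connected_continuous_connected; first exact: component_connected.
  exact: continuous_subspaceT.
by apply; exists x.
Qed.

Lemma near_mul (W : set G) (x : G) : nbhs 1%g W -> \forall y \near x, W (x^-1 * y)%g.
Proof.
have cf : {for x, continuous (fun y => x^-1 * y)%g}.
  apply: (@continuous_mulg _ _ _ _ (fun=> x^-1%g) id); last exact: cvg_id.
  exact: cst_continuous.
by rewrite -(mulVg x) => /cf.
Qed.

(** A subgroup containing a neighbourhood of [1] is open, and closed because its complement is a
    union of translates; so it contains the component of [1]. *)
Lemma identity_component_generated (W : set G) : nbhs 1%g W -> G0 `<=` gen W.
Proof.
move=> W1; have sH := generated_subgroup W.
have WH w : W w -> gen W w by move=> Ww H [_]; apply.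
have oH : open (gen W).
  rewrite openE => x Hx; rewrite /interior; apply: filterS (near_mul x W1) => y /WH Hy.
  by rewrite -(mulVKg x y); exact: (subgroupM sH).
have cH : closed (gen W).
  rewrite -openC openE => x nHx; rewrite /interior.
  apply: filterS (near_mul x W1) => y /WH Hy Hy'; apply: nHx.
  have -> : x = (y * (x^-1 * y)^-1)%g by rewrite invgM invgK mulVKg.
  exact: sH.2.
have E : G0 `&` gen W = G0.
  apply: (@component_connected G [set: G] 1%g).
  - by exists 1%g; split; [exact: connected_component_refl|exact: subgroup1 sH].
  - by exists (gen W).
  - by exists (gen W).
by rewrite -E => x [].
Qed.

Section Chart1.
Context (c : chart 'rV[R]_n G) (Ac : lie_atlas c) (c1 : chart_dom c 1%g).
Local Notation q := (center_inv c).

Lemma center_ball_nbhs (r : R) : 0 < r -> nbhs 1%g [set q v | v in [set v | `|v| < r]].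
Proof.
move=> r0; have near_dom : \forall x \near 1%g, chart_dom c x.
  by apply: open_nbhs_nbhs; split => //; exact: chart_dom_open.
have near_r : \forall x \near 1%g, `|chart_fun c 1%g - chart_fun c x| < r.
  have /cvgrPdist_lt := chart_fun_continuous c1; exact.
apply: filterS2 near_dom near_r => x dx xr; exists (center_fun c x) => /=.
  by rewrite /center_fun -normrN opprB.
exact: center_funK.
Qed.

Lemma center_ball_component : exists2 r : R, 0 < r & forall v, `|v| < r -> G0 (q v).
Proof.
have /nbhs_normP[r /= r0 hr] := center_img c1; exists r => // v vr.
have sl (t : R^o) : sdiff (fun s : R^o => s *: v) t (fun s => s *: v).
  by apply: sdiff_linear; exact: bl_scale.
have cq : {within `[0, 1], continuous ((fun t : R^o => q (t *: v)) : R -> G)}.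
  apply: continuous_in_subspaceT => t; rewrite inE/= in_itv/= => /andP[t0 t1].
  apply: (@continuous_comp R^o 'rV[R]_n G _ q t (sdiff_continuous (sl t))).
  apply: center_inv_continuous; apply: hr; rewrite /= sub0r normrN normrZ ger0_norm//.
  by rewrite (le_lt_trans _ vr)// ler_piMl.
have : (fun t : R => q (t *: v)) @` `[0, 1] `<=` G0.
  apply: connected_component_max => //.
    by exists 0; [rewrite /= in_itv/= lexx ler01|rewrite scale0r center_inv0].
  by apply: connected_continuous_connected => //; exact: segment_connected.
by apply; exists 1; [rewrite /= in_itv/= lexx ler01|rewrite scale1r].
Qed.

End Chart1.
End LieTopology.

(** * Coset representatives and the conclusion *)

Lemma finite_cosets_reps (G : groupType) (H : set G) : is_subgroup H ->
  finite_set (left_cosets H) ->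
  exists2 T : set G, finite_set T & forall g, exists2 t, T t & H (t^-1 * g)%g.
Proof.
move=> sH fH.
have [|f hf] := @choice _ _ (fun (C : set G) t =>
    left_cosets H C -> C = [set (t * h)%g | h in H]).
  move=> C; have [[g _ gC]|nC] := pselect (left_cosets H C); first by exists g.
  by exists 1%g.
exists (f @` left_cosets H); first exact: finite_image.
move=> g; set C := [set (g * h)%g | h in H].
have LC : left_cosets H C by exists g.
exists (f C); first by exists C.
have : C g by exists 1%g; [exact: subgroup1|rewrite mulg1].
by rewrite {1}(hf C LC) => -[h Hh <-]; rewrite mulKg.
Qed.

(** Elements whose image commutes with a given one form a subgroup; this is used once in each
    variable. *)
Lemma generated_commute (G K : groupType) (phi : G -> K) (S : set G) :
  {morph phi : x y / (x * y)%g} ->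
  (forall x y, S x -> S y -> (phi x * phi y = phi y * phi x)%g) ->
  forall x y, smallest (@is_subgroup G) S x -> smallest (@is_subgroup G) S y ->
    (phi x * phi y = phi y * phi x)%g.
Proof.
move=> phiM cS.
have sC z : is_subgroup [set x | commute (phi x) z].
  split; first by rewrite /= (morph_one phiM); exact/commute_sym/commute1.
  move=> x y /= cx cy; rewrite phiM (morph_inv phiM).
  apply/commute_sym/commuteM; first exact: commute_sym.
  exact/commuteV/commute_sym.
have h1 x y : smallest (@is_subgroup G) S x -> S y -> commute (phi x) (phi y).
  by move=> Sx Sy; apply: (Sx [set x | commute (phi x) (phi y)]); split=> // z Sz; exact: cS.
move=> x y Sx Sy; apply/commute_sym.
by apply: (Sy [set y | commute (phi y) (phi x)]); split=> // z Sz; exact/commute_sym/h1.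
Qed.

Lemma component_image_trivial (R : realType) (n : nat) (G : lieGroupType R n)
    (Gamma : groupType) (phi : G -> Gamma) :
  {morph phi : x y / (x * y)%g} ->
  finite_set (left_cosets (identity_component G)) ->
  finitely_generated Gamma -> set_surj [set: G] [set: Gamma] phi ->
  forall x, identity_component G x -> phi x = 1%g.
Proof.
move=> phiM fG gG sphi; have cG := finitely_generated_countable gG.
have sG0 := identity_component_subgroup G.
have [c Ac c1] := exists_chart (1%g : G).
have lc := lie_local_coordinates Ac c1; set q := center_inv c in lc.
have [P [Pk kP]] := @subspace_projector R n (ktangent q phi) (ktangent0 lc phiM)
  (ktangentD lc phiM) (@ktangentZ _ _ _ _ q phi).
have Pbl : bounded_linear (fun v : 'rV[R]_n => v *m P) by exact: bl_mulmx.
have [r r0 hr] := commutator_kernel lc (finite_frame_rV R n) phiM Pbl Pk kP cG.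
have [r' r'0 hr'] := center_ball_component c1.
pose A := phi @` identity_component G.
have sA : is_subgroup A.
  split; first by exists 1%g; [exact: subgroup1|exact: morph_one].
  move=> _ _ [x Gx <-] [y Gy <-]; exists (x * y^-1)%g; first exact: sG0.2.
  by rewrite phiM (morph_inv phiM).
have cA x y : A x -> A y -> (x * y = y * x)%g.
  move=> [g Gg <-] [h Gh <-].
  have sub := identity_component_generated (center_ball_nbhs c1 r0).
  apply: (generated_commute phiM _ (sub g Gg) (sub h Gh)).
  move=> _ _ [u ur <-] [v vr <-]; have := hr u v ur vr.
  rewrite !phiM !(morph_inv phiM) !mulgA => /divg1_eq E.
  by rewrite -/q -[in RHS]E mulgVK.
have divA m x : (0 < m)%N -> A x -> exists2 y, A y & x = (y ^+ m)%g.
  move=> m0 [g Gg <-].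
  have [d d0 hd] := local_root lc m0 r'0.
  have sub := identity_component_generated (center_ball_nbhs c1 d0).
  (* Since [A] is abelian, elements whose image has an [m]-th root in [A] form a subgroup; by
     [local_root] it contains a neighbourhood of [1]. *)
  apply: (sub g Gg [set g | exists2 y, A y & phi g = (y ^+ m)%g]); split.
    split; first by exists 1%g; [exact: subgroup1|rewrite (morph_one phiM) expg1n].
    move=> a b [y Ay Ey] [z Az Ez]; exists (y * z^-1)%g; first exact: sA.2.
    rewrite phiM (morph_inv phiM) Ey Ez expgnFl//; exact: cA.
  move=> _ [v vd <-]; have [z zr E] := hd v vd.
  exists (phi (q z)); first by exists (q z) => //; exact: hr'.
  rewrite -/q E; elim: (m) => [|k IH]; first by rewrite !expg0 (morph_one phiM).
  by rewrite !expgS phiM IH.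
have [T fT hT] := finite_cosets_reps sG0 fG.
have [S fS SA] : exists2 S, finite_set S & smallest (@is_subgroup Gamma) S = A.
  (* Inversion turns the left coset representatives of the component into right coset
     representatives of [A]. *)
  apply: (@finite_index_generated _ A [set (phi t)^-1 | t in T]%g) => //.
    exact: finite_image.
  move=> g; have [x _ xg] := sphi g^-1%g I.
  have [t Tt Gt] := hT x; exists (phi t)^-1%g; first by exists t.
  have -> : g = (phi x)^-1%g by rewrite xg invgK.
  rewrite invgK -(morph_inv phiM) -phiM -(invgK (_ * _)%g) invgM invgK (morph_inv phiM).
  apply: subgroupV => //; exists (t^-1 * x)%g => //.
have [s sE] : exists s : seq Gamma, S = [set` s] by exact/finite_seqP.
have triv1 : is_subgroup [set (1%g : Gamma)].
  by split => // x y /= -> ->; rewrite invg1 mulg1.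
have := @divisible_abelian_generated Gamma A [set 1%g] s sA cA triv1.
have h1 : [set 1%g] `<=` A by move=> x ->; exact: subgroup1.
have h2 x : x \in s -> A x by move=> xs; rewrite -SA => H [_]; apply; rewrite sE.
have h3 : A `<=` smallest (@is_subgroup Gamma) ([set 1%g] `|` [set` s]).
  rewrite -SA; apply: smallest_sub; first exact: generated_subgroup.
  by move=> x; rewrite sE => xs H [_]; apply; right.
have h4 m x : (0 < m)%N -> A x ->
    exists2 y, A y & exists2 b, [set 1%g] b & x = (y ^+ m * b)%g.
  move=> m0 /(divA m x m0)[y Ay ->]; exists y => //; exists 1%g => //.
  by rewrite mulg1.
by move=> /(_ h1 h2 h3 h4) AB x Gx; apply: AB; exists x.
Qed.

Theorem theorem3p4 (R : realType) (n : nat) (G : lieGroupType R n)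
    (Gamma : groupType) (phi : {multiplicative G -> Gamma}) :
  finite_set (left_cosets (identity_component G)) ->
  finitely_generated Gamma ->
  set_surj [set: G] [set: Gamma] phi ->
  [/\ finite_set [set: Gamma],
      continuous (phi : G -> discrete_topology Gamma) &
      forall U : set G, open U -> open (phi @` U : set (discrete_topology Gamma))].
Proof.
move=> fG gG sphi; have phiM : {morph phi : x y / (x * y)%g} by exact: gmulfM.
have triv := component_image_trivial phiM fG gG sphi.
split.
- have [T fT hT] := finite_cosets_reps (identity_component_subgroup G) fG.
  apply: sub_finite_set (finite_image phi fT) => g _.
  have [x _ <-] := sphi g I; have [t Tt /triv E] := hT x.
  exists t => //; move: E; rewrite phiM (morph_inv phiM) => E.
  by rewrite -[RHS](mulVKg (phi t)) E mulg1.
(* Continuity holds because [phi] is constant on the translate by [x] of a chart ball inside the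
   component. *)
- move=> x U /nbhs_singleton Ux.
  have [c Ac c1] := exists_chart (1%g : G).
  have [r r0 hr] := center_ball_component c1.
  apply: filterS (near_mul x (center_ball_nbhs c1 r0)) => y [v vr E] /=.
  have := triv _ (hr v vr); rewrite E phiM (morph_inv phiM) => pE.
  by rewrite -[phi y](mulVKg (phi x)) pE mulg1.
- move=> U _; exact: discrete_open.
Qed.
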